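(* For every fixed integer $d\ge 1$ and every fixed real $r>0$, as $n\to\infty$, \[ \mathbb{E}\left[\left(\frac{K_{n,d}}{n^{1-1/(2d)}}\right)^r\right]\longrightarrow\Gamma\left(1+\frac{r}{2d}\right). \] Consequently, \[ \mathbb{E}K_{n,d}\sim\Gamma\left(1+\frac{1}{2d}\right)n^{1-1/(2d)} \] and \[ \operatorname{Var}(K_{n,d})\sim\left[\Gamma\left(1+\frac1d\right)-\Gamma\left(1+\frac{1}{2d}\right)^2\right]n^{2-1/d}. \]
   Context: Fix an integer $d\ge1$. For $n>2d+1$, let $C_n^d$ be the $d$th power of the cycle: the graph on vertex set $\mathbb{Z}/n\mathbb{Z}$ in which two distinct vertices are adjacent when their cyclic distance is at most $d$. Let $\pi=(\pi_1,\dots,\pi_n)$ be a uniformly random ordering of the vertices, and $A_t=\{\pi_1,\dots,\pi_t\}$. Let $\tau_{n,d}$ be the largest $t$ such that the induced subgraph $C_n^d[A_t]$ contains an isolated vertex (a vertex of $A_t$ with no neighbor in $A_t$), and put $K_{n,d}=n-\tau_{n,d}$. Here $\Gamma$ is the Gamma function and $a_n\sim b_n$ means $a_n/b_n\to1$. *)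

(* Defs.v *)
From mathcomp Require Import all_boot all_order all_fingroup all_algebra.
From mathcomp Require Import all_classical all_reals all_analysis.
Import Order.TTheory GRing.Theory Num.Theory numFieldNormedType.Exports.

Set Implicit Arguments.
Unset Strict Implicit.
Unset Printing Implicit Defensive.

Local Open Scope ring_scope.

(* Residues modulo n are represented by 'I_n rather than 'Z_n, which would not
   have n elements for n < 2. *)
Definition cyclic_dist (n : nat) (u v : 'I_n) : nat :=
  minn ((u + (n - v)) %% n) ((v + (n - u)) %% n).

Definition cycle_power (n d : nat) : rel 'I_n :=
  fun u v => (u != v) && (cyclic_dist u v <= d)%N.

Definition has_isolated (T : finType) (e : rel T) (A : {set T}) : bool :=
  [exists v in A, [forall w in A, ~~ e v w]].

(* An ordering of the n vertices is a permutation s of 'I_n: s i is the vertex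
   in position i.+1, so [prefix_set s t] consists of the first t vertices. *)
Definition prefix_set (n : nat) (s : 'S_n) (t : nat) : {set 'I_n} :=
  [set s i | i : 'I_n & (i < t)%N].

(* For n > 0 the maximum ranges over a nonempty set: t = 1 always qualifies. *)
Definition last_isolated_time (n d : nat) (s : 'S_n) : nat :=
  \max_(t < n.+1 | has_isolated (@cycle_power n d) (prefix_set s t)) t.

Definition remaining (n d : nat) (s : 'S_n) : nat :=
  (n - last_isolated_time d s)%N.

Definition unif_expectation (R : realType) (T : finType) (X : T -> R) : R :=
  (\sum_(w : T) X w) / #|T|%:R.

Definition unif_variance (R : realType) (T : finType) (X : T -> R) : R :=
  unif_expectation (fun w => (X w - unif_expectation X) ^+ 2).

(* Euler's integral; meaningful for 0 < x, where the integrand is integrable. *)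
Definition Gamma (R : realType) (x : R) : R :=
  Rintegral (@lebesgue_measure R) `]0, +oo[%classic
    (fun t : R => t `^ (x - 1) * expR (- t)).

Definition asymp_equiv (R : realType) (a b : nat -> R) : Prop :=
  ((fun n => a n / b n) @ \oo --> (1 : R))%classic.

(* Main.v *)
Require Import Defs.
From mathcomp Require Import all_boot all_order all_fingroup all_algebra.
From mathcomp Require Import all_classical all_reals all_analysis.
From mathcomp Require Import measurable_realfun.
From mathcomp Require Import zify ring lra.
Import Order.TTheory GRing.Theory Num.Theory numFieldNormedType.Exports.

(** Read the ordering backwards. Let [B_k] be the set of the last [k]
    vertices, a uniformly random [k]-set, and [K] the number of remaining
    vertices. Then [K <= k] as soon as the complement of [B_k] has an isolated
    vertex, that is, a vertex outside [B_k] whose [2d] neighbours are all in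
    [B_k]; and [K <= k] forces some vertex, in [B_k] or not, to have all its
    neighbours in [B_k]. In the first event the configuration of bits seen
    around the vertex is [1^d 0 1^d]. A given neighbourhood is contained in
    [B_k] with probability about [(k/n)^(2d)], so with [k = n rho] and
    [n rho^(2d) = t] the expected number of such vertices is [t], the vertices
    are nearly independent, and [P(K > n rho)] tends to [exp(-t)].

    To have exact independence, the uniform [k]-set is replaced by a set that
    contains each vertex independently with probability [p]. The link is
    [mixing]: conditionally on its size, such a random set is a uniform set of
    that size. Since [K > y] is one event for all sizes, Bernoulli estimates
    pass to the ordering at the cost of a deviation of the binomial law:
    - [tail_prob_upper]: [P(K > y) P(Bin(n,p) <= y)] is at most the probability
      [pattern_free n] that [n] independent bits contain no [1^d 0 1^d];
    - [tail_prob_lower]: [P(K > y)] is at least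
      [(1 - p^(2d))^n - P(Bin(n,p) <= y)], because the events that a vertex does
      not have all its neighbours in the set are decreasing, hence positively
      correlated by Harris' inequality.

    The probability [pattern_free] is submultiplicative in the length, and on a
    block of [L + 2d] bits Bonferroni's inequality bounds it by
    [exp(-(L p^(2d) (1 - (L+1) p)))]: two occurrences in one block need [2d+1]
    ones. Taking [p = (1 -+ e) rho], Chebyshev's inequality, then [L] large and
    [e] small, gives the limit [cvg_tail]. Taking [p = rho / 4] and [L = 1]
    gives the bound [2 exp(-(c t))], uniform in [n], of [tail_prob_exp].

    For the moments put [s = r/(2d)] and let [a] be the normalizing constant.
    The layer-cake formula writes [E (K/a)^r] as the integral over [w > 0] of
    [P((K/a)^r > w)], which is [P(K > n rho)] for [t = w^(1/s)]. By dominated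
    convergence the limit is the integral of [exp(-w^(1/s))], and this is
    [Gamma(1+s)]: integrate [exp(-t)] over the region [0 < w < t^s] in both
    orders ([gamma_layer]).

    The statements on the mean and the variance are the cases [r = 1] and
    [r = 2]. For the ratios to make sense one needs [Gamma(1+s) > 0] and
    [Gamma(1+2s) - Gamma(1+s)^2 > 0]; the latter is the integral of
    [(t^s - Gamma(1+s))^2 exp(-t)], the variance of a power of an exponential
    variable. *)

Set Implicit Arguments.
Unset Strict Implicit.
Unset Printing Implicit Defensive.

Local Open Scope ring_scope.

(** * Independent bits *)

Section Bernoulli.
Variables (R : realType) (p : R).
Implicit Types (n m : nat) (F G : seq bool -> R).

(** Expectation of [F] over [n] independent bits equal to [true] with
    probability [p]. Conditioning on the first bit as the definition makes
    independence of disjoint blocks ([bern_cat]) and Harris' inequality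
    straightforward inductions. *)
Fixpoint bern n F : R :=
  if n is m.+1 then
    p * bern m (fun s => F (true :: s)) + (1 - p) * bern m (fun s => F (false :: s))
  else F [::].

Lemma eq_bern n F G : (forall s, size s = n -> F s = G s) -> bern n F = bern n G.
Proof.
elim: n F G => [|n IH] F G FG /=; first exact: FG.
by congr (_ * _ + _ * _); apply: IH => s ss; apply: FG; rewrite /= ss.
Qed.

Lemma bernD n F G : bern n (fun s => F s + G s) = bern n F + bern n G.
Proof. by elim: n F G => [//|n IH] F G /=; rewrite !IH; ring. Qed.

Lemma bernZ n a F : bern n (fun s => a * F s) = a * bern n F.
Proof. by elim: n F => [//|n IH] F /=; rewrite !IH; ring. Qed.

Lemma bern_cst n a : bern n (fun=> a) = a.
Proof. by elim: n => [//|n IH] /=; rewrite !IH; ring. Qed.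

Lemma bernB n F G : bern n (fun s => F s - G s) = bern n F - bern n G.
Proof. by elim: n F G => [//|n IH] F G /=; rewrite !IH; ring. Qed.

Lemma bern_sum n (I : Type) (r : seq I) (P : pred I) (F : I -> seq bool -> R) :
  bern n (fun s => \sum_(i <- r | P i) F i s) = \sum_(i <- r | P i) bern n (F i).
Proof.
elim: r => [|i r IH].
  rewrite big_nil -[RHS](bern_cst n 0); apply: eq_bern => s _; exact: big_nil.
rewrite big_cons -IH; case: ifPn => Pi.
  by rewrite -bernD; apply: eq_bern => s _; rewrite big_cons Pi.
by apply: eq_bern => s _; rewrite big_cons (negbTE Pi).
Qed.

Lemma bern_cat m n F G :
  bern (m + n) (fun s => F (take m s) * G (drop m s)) = bern m F * bern n G.
Proof.
elim: m F => [|m IH] F.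
  by rewrite -bernZ; apply: eq_bern => s _; rewrite take0 drop0.
by rewrite addSn /= (IH (fun s => F (true :: s))) (IH (fun s => F (false :: s))); ring.
Qed.

Lemma bern_prod n (f : nat -> bool -> R) :
  bern n (fun s => \prod_(i < n) f i (nth false s i)) =
  \prod_(i < n) (p * f i true + (1 - p) * f i false).
Proof.
elim: n f => [|n IH] f; first by rewrite /= !big_ord0.
rewrite big_ord_recl -(IH (fun i => f i.+1)) mulrDl /=; congr (_ + _).
  by rewrite -mulrA; congr (_ * _); rewrite -bernZ; apply: eq_bern => s _; rewrite big_ord_recl.
by rewrite -mulrA; congr (_ * _); rewrite -bernZ; apply: eq_bern => s _; rewrite big_ord_recl.
Qed.

Lemma bern_all n (J : seq nat) : uniq J -> all (fun j => j < n)%N J ->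
  bern n (fun s => (all (nth false s) J)%:R) = p ^+ size J.
Proof.
move=> uJ /allP Jn.
pose f i b : R := (if i \in J then b else true)%:R.
rewrite -[LHS](@eq_bern _ (fun s => \prod_(i < n) f i (nth false s i))); last first.
  move=> s ss; case: allP => [h|/allP/allPn[j jJ hj]].
    by rewrite big1 // => i _; rewrite /f; case: ifP => // /h ->.
  by rewrite (bigD1 (Ordinal (Jn _ jJ))) //= /f jJ (negbTE hj) mul0r.
rewrite bern_prod (eq_bigr (fun i : 'I_n => if val i \in J then p else 1)); last first.
  by move=> i _; rewrite /f; case: ifP => _; rewrite ?mulr1 ?mulr0 ?addr0 ?subrKC.
rewrite -big_mkcond prodr_const /=; congr (p ^+ _).
rewrite cardE -(size_map val); apply: perm_size; apply: uniq_perm => //.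
  by rewrite map_inj_uniq ?enum_uniq //; exact: val_inj.
move=> j; apply/mapP/idP => [[i]|jJ]; first by rewrite mem_enum => ? ->.
by exists (Ordinal (Jn _ jJ)); rewrite ?mem_enum.
Qed.

Lemma bern_tuple n F :
  bern n F = \sum_(t : n.-tuple bool)
    p ^+ count id t * (1 - p) ^+ (n - count id t) * F t.
Proof.
elim: n F => [|n IH] F.
  rewrite (bigD1 [tuple]) //= big1 ?addr0 ?expr0 ?mul1r // => t.
  by move/eqP; case; apply: tuple0.
rewrite (reindex (fun c : bool * n.-tuple bool => [tuple of c.1 :: c.2])) /=; last first.
  exists (fun t => (thead t, [tuple of behead t])) => [[b t] _|t _].
    by congr pair; apply: val_inj.
  by rewrite [in RHS](tuple_eta t); apply: val_inj.
rewrite -(pair_bigA _ (fun (b : bool) (t : n.-tuple bool) => p ^+ (b + count id t) *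
  (1 - p) ^+ (n.+1 - (b + count id t)) * F (b :: t))) /=.
rewrite big_bool /= !IH !big_distrr /=; congr (_ + _); apply: eq_bigr => t _.
  by rewrite add1n exprS subSS !mulrA.
have h : (count id t <= n)%N by rewrite -{2}(size_tuple t) count_size.
by rewrite add0n subSn // exprS; ring.
Qed.

Hypothesis p01 : 0 <= p <= 1.

Lemma le_bern n F G : (forall s, size s = n -> F s <= G s) -> bern n F <= bern n G.
Proof.
case/andP: p01 => p0 p1.
elim: n F G => [|n IH] F G FG /=; first exact: FG.
by apply: lerD; (apply: ler_wpM2l; [lra|apply: IH => s ss; apply: FG; rewrite /= ss]).
Qed.

Lemma bern_ge0 n F : (forall s, size s = n -> 0 <= F s) -> 0 <= bern n F.
Proof. by move=> F0; rewrite -(bern_cst n 0); apply: le_bern. Qed.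

Definition below (s t : seq bool) := all2 (fun a b => a ==> b) s t.
Definition decreasing F := forall s t, below s t -> F t <= F s.

Lemma below_refl s : below s s.
Proof. by elim: s => [//|[] s IH]; rewrite /below/=. Qed.

Lemma decreasing_cons F b : decreasing F -> decreasing (fun s => F (b :: s)).
Proof. by move=> dF s t st; apply: dF; rewrite /below /= implybb. Qed.

(** Induction on [n]: conditionally on the first bit apply the induction
    hypothesis; the two conditional expectations are ordered in the same way
    for [F] and [G], and for two such pairs the mean of the products is at least
    the product of the means (Chebyshev's sum inequality). *)
Lemma harris n F G : decreasing F -> decreasing G ->
  bern n F * bern n G <= bern n (fun s => F s * G s).
Proof.
case/andP: p01 => p0 p1.
elim: n F G => [|n IH] F G dF dG //=.
have h1 := IH _ _ (decreasing_cons true dF) (decreasing_cons true dG).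
have h0 := IH _ _ (decreasing_cons false dF) (decreasing_cons false dG).
have hF : bern n (fun s => F (true :: s)) <= bern n (fun s => F (false :: s)).
  by apply: le_bern => s _; apply: dF; exact: (below_refl s).
have hG : bern n (fun s => G (true :: s)) <= bern n (fun s => G (false :: s)).
  by apply: le_bern => s _; apply: dG; exact: (below_refl s).
move: (bern n (fun s => F (true :: s) * _)) (bern n (fun s => F (false :: s) * _)) h1 h0.
move: (bern n (fun s => F (true :: s))) (bern n (fun s => F (false :: s))) hF.
move: (bern n (fun s => G (true :: s))) (bern n (fun s => G (false :: s))) hG.
move=> g1 g0 hg f1 f0 hf c1 c0 h1 h0.
have e1 := ler_wpM2l p0 h1.
have q0 : 0 <= 1 - p by lra.
have e0 := ler_wpM2l q0 h0.
have e : 0 <= p * (1 - p) * ((f0 - f1) * (g0 - g1)).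
  by rewrite mulr_ge0 // mulr_ge0 //; lra.
apply: le_trans (lerD e1 e0).
rewrite -subr_ge0; apply: le_trans e _; rewrite le_eqVlt; apply/orP; left; apply/eqP.
by ring.
Qed.

Lemma harris_prod n (I : Type) (r : seq I) (F : I -> seq bool -> R) :
  (forall i s, 0 <= F i s) -> (forall i, decreasing (F i)) ->
  \prod_(i <- r) bern n (F i) <= bern n (fun s => \prod_(i <- r) F i s).
Proof.
move=> F0 dF; elim: r => [|i r IH].
  rewrite big_nil -[X in X <= _](bern_cst n 1).
  by apply: le_bern => s _; rewrite big_nil.
rewrite big_cons (@eq_bern _ (fun s => \prod_(j <- i :: r) F j s)
  (fun s => F i s * \prod_(j <- r) F j s)); last first.
  by move=> s _; rewrite big_cons.
apply: le_trans (harris n _ _) => //; last first.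
  by move=> s t st; apply: ler_prod => j _; rewrite F0 dF.
by apply: ler_wpM2l => //; apply: bern_ge0.
Qed.

Lemma bern_count n : bern n (fun s => (count id s)%:R) = n%:R * p.
Proof.
elim: n => [|n IH] /=; first by rewrite mul0r.
rewrite (@eq_bern _ (fun s => (1 + count id s)%:R) (fun s => 1 + (count id s)%:R)); last first.
  by move=> s _; rewrite natrD.
rewrite bernD bern_cst (@eq_bern _ (fun s => (0 + count id s)%:R) (fun s => (count id s)%:R)) //.
by rewrite IH -natr1; ring.
Qed.

(** Centring at an arbitrary [a] instead of the mean makes the induction go
    through, since the mean of the first [n] bits is not that of [n + 1]. *)
Lemma bern_var n :
  bern n (fun s => ((count id s)%:R - n%:R * p) ^+ 2) = n%:R * p * (1 - p).
Proof.
suff h a : bern n (fun s => ((count id s)%:R - a) ^+ 2) =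
    n%:R * p * (1 - p) + (n%:R * p - a) ^+ 2 by rewrite h subrr expr0n addr0.
elim: n a => [|n IH] a /=; first by ring.
rewrite (@eq_bern _ (fun s => ((1 + count id s)%:R - a)^+2)
  (fun s => ((count id s)%:R - (a - 1))^+2)); last first.
  by move=> s _; rewrite natrD; ring.
rewrite (@eq_bern _ (fun s => ((0 + count id s)%:R - a)^+2)
  (fun s => ((count id s)%:R - a)^+2)) //.
by rewrite !IH -natr1; ring.
Qed.

Lemma bern_markov n F (A : pred (seq bool)) (a : R) : 0 < a ->
  (forall s, 0 <= F s) -> (forall s, A s -> a <= F s) ->
  bern n (fun s => (A s)%:R) <= bern n F / a.
Proof.
move=> a0 F0 AF; rewrite ler_pdivlMr // mulrC -bernZ; apply: le_bern => s _.
by case: (boolP (A s)) => [/AF|_]; rewrite ?mulr1 ?mulr0.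
Qed.

End Bernoulli.

(** * From independent bits to random orderings *)

Section Mixing.

Definition ones n (s : seq bool) : {set 'I_n} := [set i : 'I_n | nth false s i].

(** The last [k] vertices of the ordering, truncated at [n]. *)
Definition suffix_set n (s : 'S_n) (k : nat) : {set 'I_n} := ~: prefix_set s (n - k).

Lemma card_ones n s : size s = n -> #|ones n s| = count id s.
Proof.
by move=> ss; rewrite -sum1dep_card -sum1_count (big_nth false) big_mkord ss.
Qed.

Lemma bern_ones (R : realType) (p : R) n (F : {set 'I_n} -> R) :
  bern p n (fun s => F (ones n s)) =
  \sum_(B : {set 'I_n}) p ^+ #|B| * (1 - p) ^+ (n - #|B|) * F B.
Proof.
rewrite bern_tuple [RHS](reindex (fun t : n.-tuple bool => ones n t)) /=.
  by apply: eq_bigr => t _; rewrite card_ones ?size_tuple.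
exists (fun B : {set (ordinal n)} => [tuple i \in B | i < n]) => [t _|B _].
  by apply: eq_from_tnth => i; rewrite tnth_mktuple inE -tnth_nth.
by apply/setP => i; rewrite inE -tnth_nth tnth_mktuple.
Qed.

Lemma perm_imset_exists (T : finType) (A B : {set T}) : #|A| = #|B| ->
  exists s : {perm T}, s @: A = B.
Proof.
move=> AB.
(* List [A] before its complement and [B] before its complement; the
   permutation sends each entry of the first list to that of the second. *)
pose sA := enum A ++ enum (~: A); pose sB := enum B ++ enum (~: B).
have uni (C : {set T}) : uniq (enum C ++ enum (~: C)).
  rewrite cat_uniq !enum_uniq andbT /=; apply/hasPn => x.
  by rewrite !mem_enum inE.
have mem (C : {set T}) x : x \in enum C ++ enum (~: C).
  by rewrite mem_cat !mem_enum inE orbN.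
have sz : size sA = size sB.
  by rewrite !size_cat -!cardE; have := cardsC A; have := cardsC B; lia.
pose f x := nth x sB (index x sA).
have fi : injective f.
  move=> x y; rewrite /f (set_nth_default x y) -?sz ?index_mem ?mem // => /eqP.
  rewrite nth_uniq -?sz ?index_mem ?mem ?uni // => /eqP h.
  by rewrite -(nth_index x (mem A x)) h nth_index ?mem.
exists (perm fi); apply/eqP; rewrite eqEcard card_imset ?AB ?leqnn ?andbT; last exact: perm_inj.
apply/fintype.subsetP => _ /imsetP[x xA ->]; rewrite permE /f /sA index_cat mem_enum xA.
have h : (index x (enum A) < size (enum B))%N by rewrite -cardE -AB cardE index_mem mem_enum.
by rewrite /sB nth_cat h -(mem_enum B) mem_nth.
Qed.

Lemma suffix_setE n (s : 'S_n) k :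
  suffix_set s k = s @: [set i : 'I_n | (n - k <= i)%N].
Proof.
apply/setP => x; rewrite inE; apply/idP/imsetP => [h|[i]].
  exists (s^-1%g x); rewrite ?permKV // inE leqNgt; apply/negP => lt.
  by move/negP: h; apply; apply/imsetP; exists (s^-1%g x); rewrite ?permKV // inE.
rewrite inE => le ->; apply/negP => /imsetP[j]; rewrite inE => jlt /perm_inj e.
by move: le; rewrite e leqNgt jlt.
Qed.

Lemma card_tail n k : (k <= n)%N -> #|[set i : 'I_n | (n - k <= i)%N]| = k.
Proof.
move=> kn; rewrite -sum1dep_card -(big_geq_mkord (n - k) n xpredT (fun=> 1%N)).
by rewrite sum_nat_const_nat; lia.
Qed.

(** Both sides run over the images of a fixed set of the same size under a
    random permutation, and any two sets of the same size are exchanged by some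
    permutation. *)
Lemma sum_suffix (R : realType) n (F : {set 'I_n} -> R) (B : {set 'I_n}) :
  \sum_(s : 'S_n) F (suffix_set s #|B|) = \sum_(s : 'S_n) F (s @: B).
Proof.
have [|t tB] := @perm_imset_exists _ [set i : 'I_n | (n - #|B| <= i)%N] B.
  by rewrite card_tail // -[X in (_ <= X)%N]card_ord max_card.
rewrite [LHS](reindex_inj (mulgI t)); apply: eq_bigr => s _.
rewrite suffix_setE -[in RHS]tB -imset_comp; congr F.
by apply: eq_imset => x; rewrite permM.
Qed.

(** Conditionally on its number of elements, a Bernoulli random set is a
    uniform set of that size, as are the last vertices of a random ordering.
    Averaging over the image by an extra random permutation makes this exact
    without computing any binomial coefficient. *)
Lemma mixing (R : realType) (p : R) n (F : {set 'I_n} -> R) :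
  bern p n (fun s => F (ones n s)) =
  unif_expectation (fun s : 'S_n => bern p n (fun b => F (suffix_set s (count id b)))).
Proof.
rewrite /unif_expectation; set w := fun B : {set 'I_n} => p ^+ #|B| * (1 - p) ^+ (n - #|B|).
rewrite (eq_bigr (fun s : 'S_n => \sum_B w B * F (suffix_set s #|B|))); last first.
  move=> s _; rewrite -bern_ones; apply: eq_bern => b sb.
  by rewrite card_ones.
rewrite exchange_big /= (eq_bigr (fun B => \sum_(s : 'S_n) w B * F (s @: B))); last first.
  by move=> B _; rewrite -!big_distrr /= sum_suffix.
rewrite exchange_big /= (eq_bigr (fun=> bern p n (fun b => F (ones n b)))); last first.
  move=> s _; rewrite bern_ones [RHS](reindex_inj (imset_inj (@perm_inj _ s))).
  by apply: eq_bigr => B _; rewrite /w card_imset //; exact: perm_inj.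
rewrite sumr_const -[X in X / _]mulr_natr mulfK // pnatr_eq0 -lt0n; apply/card_gt0P; by exists 1%g.
Qed.

End Mixing.

(** * Isolated vertices in the power of the cycle *)

Section Graph.
Variables (n d : nat).

(** When fewer than [K] vertices are missing, the last isolated time is over. *)
Lemma not_isolated_before (s : 'S_n) j : (j < remaining d s)%N ->
  ~~ has_isolated (@cycle_power n d) (~: suffix_set s j).
Proof.
rewrite /suffix_set finset.setCK; apply: contraL => iso; rewrite -leqNgt /remaining.
suff : (n - j <= last_isolated_time d s)%N by lia.
have lt : (n - j < n.+1)%N by rewrite ltnS leq_subr.
exact: (@leq_bigmax_cond _ _ (fun t : 'I_n.+1 => t : nat) (Ordinal lt)).
Qed.

(** Away from the two ends of [0 .. n-1] the cyclic neighbourhood of a vertex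
    lies in an interval of integers. This reduces occurrences of an isolated
    vertex to a pattern in a linear word. *)
Lemma cycle_power_edge (v w : 'I_n) : (d <= v)%N -> (v + d < n)%N ->
  cycle_power d v w -> exists2 a, (a <= d + d)%N && (a != d) & (w : nat) = (v - d + a)%N.
Proof.
move=> dv vd /andP[vw]; rewrite /cyclic_dist geq_min => h.
have vw' : (v : nat) != w by apply: contra vw => /eqP/val_inj ->.
have lv := ltn_ord v; have lw := ltn_ord w.
suff h2 : (w <= v + d /\ v <= w + d)%N by exists (w + d - v)%N; lia.
case/orP: h => h.
- have [wv|wv] := leqP w v.
    have e : (v + (n - w) = (v - w) + n)%N by lia.
    by move: h; rewrite e modnDr modn_small; lia.
  by move: h; rewrite modn_small; lia.
- have [wv|wv] := leqP v w.
    have e : (w + (n - v) = (w - v) + n)%N by lia.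
    by move: h; rewrite e modnDr modn_small; lia.
  by move: h; rewrite modn_small; lia.
Qed.

(** A vertex and its neighbours form a window of [2d + 1] consecutive residues;
    these are the positions in the window other than the centre. *)
Definition offsets := iota 0 d ++ iota d.+1 d.

Lemma mem_offsets a : (a \in offsets) = (a <= d + d)%N && (a != d).
Proof. by rewrite mem_cat !mem_iota; lia. Qed.

Lemma offsets_uniq : uniq offsets.
Proof.
rewrite cat_uniq !iota_uniq andbT /=; apply/hasPn => x; rewrite !mem_iota; lia.
Qed.

Lemma size_offsets : size offsets = (2 * d)%N.
Proof. by rewrite size_cat !size_iota; lia. Qed.

(** The residues [v - d + a]; adding [n - d] instead of subtracting [d] avoids
    truncation when [v < d]. *)
Definition nbrs (v : nat) := [seq ((v + (n - d) + a) %% n)%N | a <- offsets].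

Hypothesis dn : (2 * d < n)%N.

Lemma window_inj (v a b : nat) : (a <= d + d)%N -> (b <= d + d)%N ->
  ((v + (n - d) + a) %% n)%N = ((v + (n - d) + b) %% n)%N -> a = b.
Proof.
move=> ha hb /eqP; rewrite eqn_modDl !modn_small; lia.
Qed.

Lemma nbrs_uniq v : uniq (nbrs v).
Proof.
rewrite map_inj_in_uniq ?offsets_uniq // => a b.
rewrite !mem_offsets => /andP[ha _] /andP[hb _]; exact: window_inj.
Qed.

Lemma nbrs_lt v : all (fun j => j < n)%N (nbrs v).
Proof. by apply/allP => _ /mapP[a _ ->]; rewrite ltn_mod; lia. Qed.

Lemma window_edge (v w : 'I_n) a : a \in offsets ->
  (w : nat) = ((v + (n - d) + a) %% n)%N -> cycle_power d v w.
Proof.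
rewrite mem_offsets => /andP[ha ad] we.
have lv := ltn_ord v.
apply/andP; split.
  apply/negP => /eqP vw; move/eqP: ad; apply.
  apply: (@window_inj v) => //; first lia.
  rewrite -we -vw -addnA subnK; last lia.
  by rewrite modnDr modn_small.
rewrite /cyclic_dist we geq_min.
have modE (x y : nat) : (y < n)%N -> x = y %[mod n] -> (x %% n)%N = y.
  by move=> yn ->; rewrite modn_small.
case: (leqP a d) => had; apply/orP; [left|right].
- suff -> : ((v + (n - (v + (n - d) + a) %% n)) %% n = d - a)%N by lia.
  apply: modE; first lia.
  have le : ((v + (n - d) + a) %% n <= n)%N by apply: ltnW; rewrite ltn_mod; lia.
  apply/eqP; rewrite -(eqn_modDr ((v + (n - d) + a) %% n)) -addnA subnK //.
  rewrite modnDr modnDmr; apply/eqP.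
  have -> : (d - a + (v + (n - d) + a) = v + n)%N by lia.
  by rewrite modnDr.
- suff -> : (((v + (n - d) + a) %% n + (n - v)) %% n = a - d)%N by lia.
  apply: modE; first lia.
  rewrite modnDml.
  have -> : (v + (n - d) + a + (n - v) = a - d + n + n)%N by lia.
  by rewrite !modnDr.
Qed.

(** The neighbours of a vertex that is isolated when [K] vertices remain have
    all been removed, and they stay removed when more vertices are: unlike
    isolation itself, this consequence is monotone in [k]. *)
Lemma isolated_at (s : 'S_n) k : (remaining d s <= k)%N ->
  exists v : 'I_n, [forall w : 'I_n, ((w : nat) \in nbrs v) ==> (w \in suffix_set s k)].
Proof.
move=> Kk; have n0 : (0 < n)%N by lia.
set P : pred 'I_n.+1 := fun t => has_isolated (@cycle_power n d) (prefix_set s t).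
(* A single vertex is isolated, so the maximum is attained by some time. *)
have P1 : P (inord 1).
  rewrite /P inordK ?ltnS //; apply/existsP; exists (s (Ordinal n0)).
  have mem1 v : (v \in prefix_set s 1) = (v == s (Ordinal n0)).
    apply/imsetP/eqP => [[i]|->]; last by exists (Ordinal n0); rewrite ?inE.
    by rewrite inE ltnS leqn0 => /eqP i0 ->; congr (s _); apply: val_inj.
  rewrite mem1 eqxx; apply/forallP => w; rewrite mem1; apply/implyP => /eqP ->.
  by rewrite /cycle_power eqxx.
have [|t Pt te] := @eq_bigmax_cond _ P (fun t : 'I_n.+1 => t : nat).
  by apply/card_gt0P; exists (inord 1).
have tE : (t : nat) = (n - remaining d s)%N.
  rewrite /remaining /last_isolated_time -/P te subKn //.
  by rewrite -ltnS ltn_ord.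
move: Pt; rewrite /P => /existsP[v /andP[vA /forallP iso]].
exists v; apply/forallP => w; apply/implyP => /mapP[a ao we].
have e := window_edge ao we.
rewrite inE; apply/negP => wA; have := iso w; rewrite e implybF => /negP; apply.
have sub : (n - k <= t)%N by rewrite tE; lia.
move: wA => /imsetP[i]; rewrite inE => ik ->; apply/imsetP; exists i => //.
by rewrite inE (leq_trans ik).
Qed.

End Graph.

(** The factor [1^d 0 1^d] at position [i]: an unremoved vertex, at [i + d], all
    of whose neighbours are removed. *)
Definition pattern d (s : seq bool) i :=
  all (fun a => nth false s (i + a) == (a != d)) (iota 0 (2 * d).+1).

Definition has_pattern d (s : seq bool) := has (pattern d s) (iota 0 (size s - 2 * d)).

Lemma pattern_isolated n d s : size s = n ->
  has_pattern d s -> has_isolated (@cycle_power n d) (~: ones n s).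
Proof.
move=> ss /hasP[i]; rewrite mem_iota ss add0n => /andP[_ ilt] /allP pat.
have lt : (i + d < n)%N by lia.
apply/existsP; exists (Ordinal lt); apply/andP; split.
  rewrite !inE /=; have := pat d; rewrite mem_iota eqxx => h.
  by rewrite (eqP (h _)) //; lia.
apply/forallP => w; apply/implyP; rewrite !inE; apply: contra => e.
have [|/=|a /andP[ha ad] we] := cycle_power_edge _ _ e; [rewrite /=; lia|lia|].
have := pat a; rewrite mem_iota ad => h.
by rewrite we /= addnK (eqP (h _)) //; lia.
Qed.

(** * Avoiding the pattern 1^d 0 1^d *)

Lemma ler_bool (R : realType) (a b : bool) : (a -> b) -> a%:R <= b%:R :> R.
Proof. by case: a; case: b => // /(_ isT). Qed.

Section UnifExpectation.
Variables (R : realType) (T : finType).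
Implicit Types X Y : T -> R.

Lemma eq_unif X Y : X =1 Y -> unif_expectation X = unif_expectation Y.
Proof. by move=> XY; rewrite /unif_expectation (eq_bigr Y). Qed.

Lemma le_unif X Y : (forall w, X w <= Y w) -> unif_expectation X <= unif_expectation Y.
Proof.
by move=> XY; rewrite /unif_expectation ler_wpM2r ?invr_ge0 ?ler0n // ler_sum.
Qed.

Lemma unifD X Y :
  unif_expectation (fun w => X w + Y w) = unif_expectation X + unif_expectation Y.
Proof. by rewrite /unif_expectation big_split mulrDl. Qed.

Lemma unifZ a X : unif_expectation (fun w => a * X w) = a * unif_expectation X.
Proof. by rewrite /unif_expectation -mulr_sumr mulrA. Qed.

Hypothesis T0 : (0 < #|T|)%N.

Lemma unif_cst (a : R) : unif_expectation (fun _ : T => a) = a.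
Proof.
rewrite /unif_expectation sumr_const -[X in X / _]mulr_natr mulfK //.
by rewrite pnatr_eq0 -lt0n.
Qed.

End UnifExpectation.

Lemma perm_card_gt0 n : (0 < #|{: 'S_n}|)%N.
Proof. by apply/card_gt0P; exists 1%g. Qed.

Section Pattern.
Variables (R : realType) (p : R) (d : nat).
Hypothesis p01 : 0 <= p <= 1.

Definition pattern_free n : R := bern p n (fun s => (~~ has_pattern d s)%:R).

Lemma pattern_free_ge0 n : 0 <= pattern_free n.
Proof. by apply: bern_ge0 => // s _; exact: ler0n. Qed.

Lemma pattern_free_le1 n : pattern_free n <= 1.
Proof.
rewrite -[X in _ <= X](bern_cst p n); apply: le_bern => // s _.
by rewrite lern1 leq_b1.
Qed.

(** A word avoiding the pattern avoids it in each of two disjoint factors, which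
    are independent. *)
Lemma pattern_free_submul m n : pattern_free (m + n) <= pattern_free m * pattern_free n.
Proof.
rewrite -bern_cat; apply: le_bern => // s ss.
suff h : has_pattern d (take m s) || has_pattern d (drop m s) -> has_pattern d s.
  move: h; case: (has_pattern d s) => [_|]; first exact: mulr_ge0.
  by case: has_pattern; case: has_pattern => //= h; rewrite ?mulr1 //; have := h isT.
rewrite /has_pattern size_drop size_takel ?ss ?leq_addr // addKn.
case/orP => /hasP[i]; rewrite mem_iota => /andP[_ ilt] /allP pat; apply/hasP.
  exists i; first by rewrite mem_iota; lia.
  apply/allP => a am; have := pat a am; rewrite nth_take //.
  by move: am; rewrite mem_iota; lia.
exists (m + i)%N; first by rewrite mem_iota; lia.
by apply/allP => a am; have := pat a am; rewrite nth_drop addnA.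
Qed.

Lemma pattern_free_block M n : pattern_free n <= pattern_free M ^+ (n %/ M).
Proof.
rewrite {1}(divn_eq n M); elim: (n %/ M)%N => [|k IH]; first by rewrite expr0 pattern_free_le1.
rewrite mulSn -addnA exprS; apply: le_trans (pattern_free_submul _ _) _.
by apply: ler_wpM2l => //; exact: pattern_free_ge0.
Qed.

Lemma patternE s i : pattern d s i =
  all (nth false s) [seq (i + a)%N | a <- offsets d] && ~~ nth false s (i + d).
Proof.
apply/allP/andP => [h|[/allP h1 h2]].
  split.
    apply/allP => x /mapP[a]; rewrite mem_offsets => /andP[ha ad] ->.
    have am : a \in iota 0 (2 * d).+1 by rewrite mem_iota; lia.
    by rewrite (eqP (h a am)).
  have dm : d \in iota 0 (2 * d).+1 by rewrite mem_iota; lia.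
  by rewrite (eqP (h d dm)) eqxx.
move=> a; rewrite mem_iota => am; have [->|ad] := eqVneq a d; first by rewrite (negbTE h2).
by rewrite h1 // map_f // mem_offsets ad andbT; lia.
Qed.

(** The ones of the pattern are present, but not with a one at the centre as
    well; both are conditions on a set of ones only. *)
Lemma bern_pattern n i : (i + 2 * d < n)%N ->
  bern p n (fun s => (pattern d s i)%:R) = p ^+ (2 * d) - p ^+ (2 * d).+1.
Proof.
move=> hi; set J := [seq (i + a)%N | a <- offsets d].
have uJ : uniq ((i + d)%N :: J).
  rewrite /= map_inj_uniq ?offsets_uniq ?andbT; last by move=> x y; lia.
  by apply/mapP => -[a]; rewrite mem_offsets => /andP[_ /eqP ad]; lia.
have sJ : size J = (2 * d)%N by rewrite size_map size_offsets.
have Jn : all (fun j => j < n)%N ((i + d)%N :: J).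
  rewrite /=; apply/andP; split; first lia.
  by apply/allP => x /mapP[a]; rewrite mem_offsets => /andP[ha _] ->; lia.
have -> : (2 * d).+1 = size ((i + d)%N :: J) by rewrite /= sJ.
rewrite -sJ -(bern_all p uJ Jn).
rewrite -(bern_all p (n := n) (J := J)) //; last by case/andP: Jn.
  rewrite -bernB; apply: eq_bern => s _; rewrite patternE -/J /=.
  by case: all; case: nth; rewrite /= ?subr0 ?subrr.
by case/andP: uJ.
Qed.

(** The last one of the second occurrence lies beyond the first window, so two
    occurrences require at least [2d + 1] ones. *)
Lemma bern_pattern2 n i j : (i < j)%N -> (j + 2 * d < n)%N -> (0 < d)%N ->
  bern p n (fun s => (pattern d s i && pattern d s j)%:R) <= p ^+ (2 * d).+1.
Proof.
move=> ij hj d0; set J := (j + 2 * d)%N :: [seq (i + a)%N | a <- offsets d].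
have -> : (2 * d).+1 = size J by rewrite /= size_map size_offsets.
rewrite -(bern_all p (n := n)).
- apply: le_bern => // s _; rewrite ler_nat; case: (boolP (_ && _)) => // /andP[].
  rewrite !patternE => /andP[h1 _] /andP[/allP h2 _].
  by rewrite /= h1 h2 // map_f // mem_offsets; lia.
- rewrite /= map_inj_uniq ?offsets_uniq ?andbT; last by move=> x y; lia.
  by apply/mapP => -[a]; rewrite mem_offsets => /andP[ha ad]; lia.
- apply/andP; split; first lia.
  by apply/allP => x /mapP[a]; rewrite mem_offsets => /andP[ha _] ->; lia.
Qed.

Lemma has_iota_recr (A : pred nat) L : has A (iota 0 L.+1) = has A (iota 0 L) || A L.
Proof. by rewrite -addn1 iotaD has_cat /= orbF. Qed.

Lemma bonferroni1 (A : pred nat) L :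
  1 - \sum_(i < L) (A i)%:R <= (~~ has A (iota 0 L))%:R :> R.
Proof.
elim: L => [|L IH]; first by rewrite big_ord0 subr0.
rewrite has_iota_recr big_ord_recr /= negb_or.
move: IH; case: (A L); case: has => /=; lra.
Qed.

Lemma bonferroni2 (A : pred nat) L :
  (~~ has A (iota 0 L))%:R <=
  1 - \sum_(i < L) (A i)%:R + \sum_(i < L) \sum_(j < i) (A j && A i)%:R :> R.
Proof.
elim: L => [|L IH]; first by rewrite !big_ord0 subr0 addr0.
rewrite has_iota_recr !big_ord_recr /= negb_or.
have h1 := bonferroni1 A L.
case: (A L) => /=.
  under [X in _ <= _ + (_ + X)]eq_bigr do rewrite andbT.
  by move: IH h1; case: has => /=; lra.
under [X in _ <= _ + (_ + X)]eq_bigr do rewrite andbF.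
by rewrite [X in _ <= _ + (_ + X)]big1 // andbT !addr0.
Qed.

(** The second Bonferroni inequality on the [L] possible positions: the linear
    term is [L (p^(2d) - p^(2d+1))] and there are at most [L^2] pairs. *)
Lemma pattern_free_block_le L : (0 < d)%N ->
  pattern_free (L + 2 * d) <= expR (- (L%:R * p ^+ (2 * d) * (1 - L.+1%:R * p))).
Proof.
move=> d0; apply: le_trans (expR_ge1Dx _).
set n := (L + 2 * d)%N.
apply: (@le_trans _ _ (1 - L%:R * (p ^+ (2 * d) - p ^+ (2 * d).+1)
    + L%:R ^+ 2 * p ^+ (2 * d).+1)); last first.
  by rewrite exprS -natr1 le_eqVlt; apply/orP; left; apply/eqP; ring.
have -> : L%:R * (p ^+ (2 * d) - p ^+ (2 * d).+1) =
    bern p n (fun s => \sum_(i < L) (pattern d s i)%:R).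
  rewrite bern_sum (eq_bigr (fun=> p ^+ (2 * d) - p ^+ (2 * d).+1)) => [|i _].
    by rewrite sumr_const card_ord mulr_natl.
  by rewrite bern_pattern // /n ltn_add2r.
rewrite -{1}(bern_cst p n 1) -bernB.
have h : bern p n (fun s => \sum_(i < L) \sum_(j < i) (pattern d s j && pattern d s i)%:R)
    <= L%:R ^+ 2 * p ^+ (2 * d).+1.
  have pp : 0 <= p ^+ (2 * d).+1 by apply: exprn_ge0; case/andP: p01.
  rewrite bern_sum; apply: (@le_trans _ _ (\sum_(i < L) L%:R * p ^+ (2 * d).+1)).
    apply: ler_sum => i _; rewrite bern_sum.
    apply: (@le_trans _ _ (\sum_(j < i) p ^+ (2 * d).+1)).
      by apply: ler_sum => j _; apply: bern_pattern2; rewrite ?ltn_add2r.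
    rewrite sumr_const card_ord -[leLHS]mulr_natl ler_wpM2r // ler_nat.
    exact/ltnW/ltn_ord.
  by rewrite sumr_const card_ord -[leLHS]mulr_natl expr2 mulrA.
apply: le_trans (lerD (lexx _) h); rewrite -bernD; apply: le_bern => // s ss.
by rewrite /has_pattern ss /n addnK bonferroni2.
Qed.

End Pattern.

(** * Comparison of the ordering with independent bits *)

Section Process.
Variables (R : realType) (p : R) (n d : nat).
Hypothesis p01 : 0 <= p <= 1.
Hypothesis dn : (2 * d < n)%N.
Implicit Type y : R.

Definition tail_prob y : R :=
  unif_expectation (fun s : 'S_n => (y < (remaining d s)%:R)%R%:R).

Lemma tail_prob_ge0 y : 0 <= tail_prob y.
Proof.
by rewrite -(unif_cst (perm_card_gt0 n) 0); apply: le_unif => s; exact: ler0n.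
Qed.

Lemma tail_prob_le1 y : tail_prob y <= 1.
Proof.
rewrite -[leRHS](unif_cst (perm_card_gt0 n)); apply: le_unif => s.
by rewrite lern1 leq_b1.
Qed.

Definition small_prob y : R := bern p n (fun s => ((count id s)%:R <= y)%R%:R).

(** If [j <= y < K], removing the last [j] vertices leaves no isolated vertex,
    and by [mixing] a Bernoulli set of size [j] has the law of the last [j]
    vertices. *)
Lemma tail_prob_upper y : tail_prob y * small_prob y <= pattern_free p d n.
Proof.
pose F (B : {set 'I_n}) : R := (~~ has_isolated (@cycle_power n d) (~: B))%:R.
apply: (@le_trans _ _ (bern p n (fun s => F (ones n s)))); last first.
  apply: le_bern => // s ss; apply: ler_bool; apply: contra; exact: pattern_isolated.
rewrite mixing mulrC -unifZ; apply: le_unif => s.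
rewrite mulrC -bernZ; apply: le_bern => // b sb.
have [yK|_] := ltrP y (remaining d s)%:R; last by rewrite mul0r.
have [cy|_] := lerP (count id b)%:R y; last by rewrite mulr0.
rewrite /F not_isolated_before ?mulr1 // -(ltr_nat R); exact: le_lt_trans yK.
Qed.

(** If [j > y] and the last [j] vertices contain no full neighbourhood, then
    [K > j > y]. Avoiding the neighbourhood of one vertex has probability
    [1 - p^(2d)], and Harris' inequality bounds the probability of avoiding all
    of them by the product. *)
Lemma tail_prob_lower y : (1 - p ^+ (2 * d)) ^+ n - small_prob y <= tail_prob y.
Proof.
pose avoid (v : 'I_n) (B : {set 'I_n}) := ~~ [forall w : 'I_n, ((w : nat) \in nbrs n d v) ==> (w \in B)].
pose F (B : {set 'I_n}) : R := [forall v, avoid v B]%:R.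
rewrite lerBlDr.
apply: (@le_trans _ _ (bern p n (fun s => F (ones n s)))); last first.
  rewrite mixing -[small_prob y](unif_cst (perm_card_gt0 n)) -unifD.
  apply: le_unif => s; rewrite -[X in X + _](bern_cst p n) -bernD.
  apply: le_bern => // b sb.
  have [yK|Ky] := ltrP y (remaining d s)%:R.
    by apply: (@le_trans _ _ 1); rewrite ?lerDl // /F lern1 leq_b1.
  rewrite add0r; have [_|yc] := lerP (count id b)%:R y; first by rewrite /F lern1 leq_b1.
  rewrite /F; case: forallP => // h.
  have [|v] := isolated_at dn (s := s) (k := count id b).
    by rewrite -(ler_nat R); apply/ltW; exact: le_lt_trans Ky yc.
  by have := h v; rewrite /avoid => /negP.
have -> : (1 - p ^+ (2 * d)) ^+ n =
    \prod_(v : 'I_n) bern p n (fun s => (~~ all (nth false s) (nbrs n d v))%:R).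
  rewrite -{1}(card_ord n) -prodr_const; apply: eq_bigr => v _.
  rewrite -[X in X - _ = _](bern_cst p n 1) -(size_offsets d) -(size_map (fun a => (v + (n - d) + a) %% n)%N).
  rewrite -(bern_all p (n := n)); [|exact: nbrs_uniq|exact: nbrs_lt].
  rewrite -bernB; apply: eq_bern => s _; rewrite -/(nbrs n d v).
  by case: (all _ _); rewrite /= ?subrr ?subr0.
apply: le_trans.
  apply: harris_prod => // v s t.
  move=> st; apply: ler_bool; apply: contra.
  have nthst i : nth false s i -> nth false t i.
    elim: s t i st => [|a s IH] [|b t] [|i] //= /andP[ab st]; first by move/implyP: ab.
    exact: IH.
  by apply: sub_all.
apply: le_bern => // s ss; rewrite /F; case: forallP => [h|/forallP/forallPn[v]].
  by apply: prodr_ile1 => v _; rewrite ler0n lern1 leq_b1.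
rewrite negbK => /forallP hv.
rewrite (bigD1 v) //= (_ : all _ _) ?mul0r //.
apply/allP => j jn; have jlt := allP (nbrs_lt dn v) j jn.
by have := hv (Ordinal jlt); rewrite jn inE.
Qed.

End Process.

(** * Tail bounds *)

Section Concentration.
Variables (R : realType) (p : R) (n : nat).
Hypothesis p01 : 0 <= p <= 1.

Lemma large_prob y : 1 - small_prob p n y = bern p n (fun s => (y < (count id s)%:R)%R%:R).
Proof.
rewrite -[X in X - _ = _](bern_cst p n 1) -bernB; apply: eq_bern => s _.
by case: ltrP; rewrite ?subr0 ?subrr.
Qed.

Lemma large_prob_markov y : 0 < y -> 1 - small_prob p n y <= n%:R * p / y.
Proof.
move=> y0; rewrite large_prob -bern_count; apply: bern_markov => // s.
exact: ltW.
Qed.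

Lemma large_prob_chebyshev y : n%:R * p < y ->
  1 - small_prob p n y <= n%:R * p / (y - n%:R * p) ^+ 2.
Proof.
move=> npy; rewrite large_prob.
have h : 0 < (y - n%:R * p) ^+ 2 by rewrite exprn_gt0 // subr_gt0.
apply: (@le_trans _ _ (n%:R * p * (1 - p) / (y - n%:R * p) ^+ 2)).
  rewrite -bern_var; apply: bern_markov => // [s|s ys]; first exact: sqr_ge0.
  by rewrite ler_pXn2r ?nnegrE //; lra.
case/andP: p01 => p0 p1.
apply: ler_wpM2r; first by rewrite invr_ge0 ltW.
by rewrite ler_piMr ?mulr_ge0 //; lra.
Qed.

Lemma small_prob_chebyshev y : y < n%:R * p ->
  small_prob p n y <= n%:R * p / (n%:R * p - y) ^+ 2.
Proof.
move=> npy.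
have h : 0 < (n%:R * p - y) ^+ 2 by rewrite exprn_gt0 // subr_gt0.
apply: (@le_trans _ _ (n%:R * p * (1 - p) / (n%:R * p - y) ^+ 2)).
  rewrite -bern_var; apply: bern_markov => // [s|s ys]; first exact: sqr_ge0.
  rewrite -[leRHS]sqrrN ler_pXn2r ?nnegrE //; lra.
case/andP: p01 => p0 p1.
apply: ler_wpM2r; first by rewrite invr_ge0 ltW.
by rewrite ler_piMr ?mulr_ge0 //; lra.
Qed.

End Concentration.

Section Bounds.
Variables (R : realType) (n d : nat).
Hypothesis d0 : (0 < d)%N.
Hypothesis dn : (2 * d < n)%N.

Lemma pattern_free_exp_le (p : R) L : 0 <= p <= 1 ->
  pattern_free p d n <= expR (- ((n %/ (L + 2 * d))%:R *
     (L%:R * p ^+ (2 * d) * (1 - L.+1%:R * p)))).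
Proof.
move=> p01; apply: le_trans (pattern_free_block d p01 (L + 2 * d) n) _.
rewrite -mulrN expRM_natl; apply: lerXn2r; rewrite ?nnegrE ?expR_ge0 ?pattern_free_ge0 //.
exact: pattern_free_block_le.
Qed.

Lemma remaining_le (s : 'S_n) : (remaining d s <= n)%N.
Proof. exact: leq_subr. Qed.

(** With [p = rho / 4], the factor [4^(2d)] comes from [p^(2d)], a factor [2]
    from [1 - 2 p >= 1/2], and [2 (2d + 1)] from rounding [n / (2d + 1)] down. *)
Definition rate : R := (4 ^+ (2 * d) * (4 * (2 * d).+1%:R))^-1.

Lemma rate_gt0 : 0 < rate.
Proof. by rewrite invr_gt0 mulr_gt0 // mulr_gt0. Qed.

(** Blocks of the minimal length [2d + 1] suffice here. For [p = rho / 4],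
    Markov's inequality already gives [P(Bin(n,p) <= n rho) >= 1/2]. *)
Lemma tail_prob_exp (rho : R) : 0 < rho ->
  tail_prob n d (n%:R * rho) <= 2 * expR (- (rate * (n%:R * rho ^+ (2 * d)))).
Proof.
move=> r0; have n0 : 0 < n%:R :> R by rewrite ltr0n; lia.
(* For [rho > 1] the event is empty, since [K <= n]. *)
have [r1|r1] := ltrP 1 rho.
  apply: (@le_trans _ _ 0); last by rewrite mulr_ge0 // expR_ge0.
  rewrite -(unif_cst (perm_card_gt0 n) 0); apply: le_unif => s.
  rewrite (_ : (_ < _) = false) //; apply/negbTE; rewrite -leNgt.
  apply: (@le_trans _ _ n%:R); first by rewrite ler_nat remaining_le.
  by rewrite ler_peMr ?ltW.
set p := rho / 4.
have p01 : 0 <= p <= 1 by rewrite /p; apply/andP; split; lra.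
have sm : 1 / 2 <= small_prob p n (n%:R * rho).
  suff : 1 - small_prob p n (n%:R * rho) <= 1 / 2 by lra.
  apply: le_trans (large_prob_markov n p01 _) _; first exact: mulr_gt0.
  rewrite ler_pdivrMr ?mulr_gt0 // /p.
  have := mulr_gt0 n0 r0; lra.
have up := tail_prob_upper n d p01 (n%:R * rho).
have T0 := tail_prob_ge0 n d (n%:R * rho).
have := pattern_free_exp_le 1 p01.
set E := expR _ => QE.
have TE : tail_prob n d (n%:R * rho) <= 2 * E.
  have h : tail_prob n d (n%:R * rho) * (1 / 2) <=
      tail_prob n d (n%:R * rho) * small_prob p n (n%:R * rho) by rewrite ler_wpM2l.
  by have := le_trans h (le_trans up QE); lra.
apply: le_trans TE _; rewrite ler_pM2l // ler_expR lerN2 mul1r.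
have e1 : p ^+ (2 * d) = rho ^+ (2 * d) / 4 ^+ (2 * d) by rewrite exprMn exprVn.
rewrite e1 /rate.
have h2 : n%:R / (2 * (2 * d).+1%:R) <= (n %/ (1 + 2 * d))%:R :> R.
  rewrite ler_pdivrMr ?mulr_gt0 // -!natrM ler_nat add1n.
  have := divn_eq n (2 * d).+1.
  have := ltn_pmod n (isT : (0 < (2 * d).+1)%N).
  have : (0 < n %/ (2 * d).+1)%N by rewrite divn_gt0.
  move: (n %/ _)%N (n %% _)%N => q r; nia.
have h3 : 1 / 2 <= 1 - 2 * p by rewrite /p; lra.
set X := rho ^+ (2 * d); set Y := 4 ^+ (2 * d).
have X0 : 0 < X by apply: exprn_gt0.
have Y0 : 0 < Y by apply: exprn_gt0.
apply: (@le_trans _ _ (n%:R / (2 * (2 * d).+1%:R) * (X / Y * (1 / 2)))).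
  rewrite le_eqVlt; apply/orP; left; apply/eqP; field.
  by rewrite -natrM nat1r pnatr_eq0 /= gt_eqF.
have XY : 0 <= X / Y by rewrite divr_ge0 // ltW.
apply: ler_pM; [by rewrite mulr_ge0 // invr_ge0|by rewrite mulr_ge0|exact: h2|].
exact: ler_wpM2l.
Qed.

(** From [exp(x/(1-x)) >= 1 + x/(1-x) = 1/(1-x)]. *)
Lemma exp_le_one_sub_pow (x : R) : 0 <= x < 1 -> expR (- (n%:R * (x / (1 - x)))) <= (1 - x) ^+ n.
Proof.
case/andP => x0 x1; rewrite -mulrN expRM_natl; apply: lerXn2r.
- by rewrite nnegrE expR_ge0.
- by rewrite nnegrE; lra.
rewrite expRN -[leRHS]invrK lef_pV2 ?posrE ?expR_gt0 ?invr_gt0 ?subr_gt0 //.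
apply: le_trans (expR_ge1Dx _); rewrite le_eqVlt; apply/orP; left; apply/eqP.
by field; rewrite gt_eqF // subr_gt0.
Qed.

End Bounds.

(** * The limiting tail *)

Local Open Scope classical_set_scope.
Local Open Scope ring_scope.

Lemma cvg_exprn (R : realType) (f : nat -> R) (l : R) k :
  f @ \oo --> l -> f n ^+ k @[n --> \oo] --> l ^+ k.
Proof.
move=> fl; apply: (@continuous_cvg _ _ _ _ _ f (fun x : R => x ^+ k) l) => //.
exact: exprn_continuous.
Qed.

Lemma cvg_expRN (R : realType) (f : nat -> R) (l : R) :
  f @ \oo --> l -> expR (- f n) @[n --> \oo] --> expR (- l).
Proof.
move=> fl; apply: (@continuous_cvg _ _ _ _ _ (fun n => - f n) expR (- l)).
  exact: continuous_expR.
exact: cvgN.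
Qed.

Section Limit.
Variables (R : realType) (d : nat).
Hypothesis d0 : (0 < d)%N.

Lemma cvg_invn : (n%:R^-1 : R) @[n --> \oo] --> (0 : R).
Proof. by rewrite -cvg_shiftS; exact: cvg_harmonic. Qed.

Lemma cvg_divn_ratio (M : nat) : (0 < M)%N ->
  ((n %/ M)%:R / n%:R : R) @[n --> \oo] --> (M%:R^-1 : R).
Proof.
move=> M0; have M0' : 0 < M%:R :> R by rewrite ltr0n.
apply: (@squeeze_cvgr _ _ _ _ (fun n => M%:R^-1 - n%:R^-1) (fun=> M%:R^-1)).
- near=> n; have n0 : (0 < n)%N by near: n; exact: nbhs_infty_gt.
  have n0' : 0 < n%:R :> R by rewrite ltr0n.
  have e := divn_eq n M; have l := ltn_pmod n M0.
  apply/andP; split.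
    rewrite lerBlDr -(ler_pM2r M0') -(ler_pM2r n0') mulVf ?gt_eqF // mul1r.
    rewrite [leRHS](_ : _ = (n %/ M)%:R * M%:R + M%:R); last by field; rewrite gt_eqF.
    rewrite -natrM -natrD ler_nat; lia.
  rewrite ler_pdivrMr // -(ler_pM2r M0') -mulrA [n%:R * _]mulrC mulrA mulVf ?gt_eqF // mul1r.
  by rewrite -natrM ler_nat; lia.
- rewrite -[X in _ --> X]subr0; apply: cvgB; [exact: cvg_cst|exact: cvg_invn].
- exact: cvg_cst.
Unshelve. all: by end_near. Qed.

Variable t : R.
Hypothesis t0 : 0 < t.

(** The density [rho] for which [n rho^(2d) = t]: the [n] vertices have on average
    [t] full neighbourhoods in a random set of density [rho]. *)
Definition scale (n : nat) : R := (t / n%:R) `^ ((2 * d)%:R^-1).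

Lemma scale_gt0 n : (0 < n)%N -> 0 < scale n.
Proof. by move=> n0; rewrite powR_gt0 // divr_gt0 // ltr0n. Qed.

Lemma scaleX n : scale n ^+ (2 * d) = t / n%:R.
Proof.
rewrite -powR_mulrn ?powR_ge0 // -powRrM mulVf ?powRr1 //.
  by rewrite divr_ge0 // ltW.
by rewrite pnatr_eq0 muln_eq0 negb_or /= -lt0n.
Qed.

Lemma scaleX_n n : (0 < n)%N -> n%:R * scale n ^+ (2 * d) = t.
Proof. by move=> n0; rewrite scaleX mulrC divfK // pnatr_eq0 -lt0n. Qed.

Lemma cvg_scale : scale n @[n --> \oo] --> (0 : R).
Proof.
rewrite -cvg_shiftS.
have a0 : 0 < (2 * d)%:R^-1 :> R by rewrite invr_gt0 ltr0n muln_gt0.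
have /cvg_at_rightP := powR_cvg0 a0.
move/(_ (fun n => t / n.+1%:R)); apply; split=> [n|].
  by rewrite divr_gt0.
by rewrite -[X in _ --> X](mulr0 t); apply: cvgM; [exact: cvg_cst|exact: cvg_harmonic].
Qed.

Lemma cvg_inv_scale : ((n%:R * scale n)^-1 : R) @[n --> \oo] --> (0 : R).
Proof.
have h : (scale n ^+ (2 * d).-1 / t) @[n --> \oo] --> (0 : R).
  rewrite -[X in _ --> X](mul0r t^-1); apply: cvgM; last exact: cvg_cst.
  have -> : (0 : R) = 0 ^+ (2 * d).-1 by rewrite expr0n; case: d d0 => // k _; rewrite mulnS.
  exact/cvg_exprn/cvg_scale.
apply: cvg_trans h; apply: near_eq_cvg; near=> n.
have n0 : (0 < n)%N by near: n; exact: nbhs_infty_gt.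
have s0 := scale_gt0 n0.
rewrite -(scaleX_n n0).
have -> : scale n ^+ (2 * d) = scale n * scale n ^+ (2 * d).-1.
  by rewrite -exprS prednK // muln_gt0.
by field; rewrite !gt_eqF ?ltr0n ?exprn_gt0.
Unshelve. all: by end_near. Qed.

Let T n := tail_prob n d (n%:R * scale n).

Lemma cvg_pow_scale (c : R) : (n%:R * (c * scale n) ^+ (2 * d)) @[n --> \oo] --> (c ^+ (2 * d) * t).
Proof.
apply: (@cvg_trans _ ((fun=> c ^+ (2 * d) * t) @ \oo)); last exact: cvg_cst.
apply: near_eq_cvg; near=> n.
have n0 : (0 < n)%N by near: n; exact: nbhs_infty_gt.
by rewrite exprMn mulrCA scaleX_n.
Unshelve. all: by end_near. Qed.

(** Take [p = (1 - e) rho]. Chebyshev's inequality makes the binomial deviation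
    [O(1/(n rho))], and blocks of length [L + 2d] give the exponential. *)
Lemma tail_near_le (e : R) (L : nat) (b : R) : 0 < e < 1 ->
  expR (- (L%:R / (L + 2 * d)%:R * (1 - e) ^+ (2 * d) * t)) < b ->
  \forall n \near \oo, T n < b.
Proof.
case/andP => e0 e1 hb; set M := (L + 2 * d)%N.
pose p n := (1 - e) * scale n.
pose x n : R := (n %/ M)%:R / n%:R * (L%:R * (n%:R * p n ^+ (2 * d)) * (1 - L.+1%:R * p n)).
pose del n := (1 - e) / e ^+ 2 * (n%:R * scale n)^-1.
have M0 : (0 < M)%N by rewrite addn_gt0 muln_gt0 d0 orbT.
have xl : x @ \oo --> L%:R / M%:R * (1 - e) ^+ (2 * d) * t.
  have -> : L%:R / M%:R * (1 - e) ^+ (2 * d) * t =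
     M%:R^-1 * (L%:R * ((1 - e) ^+ (2 * d) * t) * (1 - L.+1%:R * ((1 - e) * 0))) by ring.
  apply: cvgM; first exact: cvg_divn_ratio.
  apply: cvgM; first by apply: cvgM; [exact: cvg_cst|exact: cvg_pow_scale].
  apply: cvgB; first exact: cvg_cst.
  apply: cvgM; first exact: cvg_cst.
  apply: cvgM; [exact: cvg_cst|exact: cvg_scale].
have : (expR (- x n) + del n) @[n --> \oo] -->
    expR (- (L%:R / M%:R * (1 - e) ^+ (2 * d) * t)) + (1 - e) / e ^+ 2 * 0.
  apply: cvgD.
    exact: cvg_expRN.
  by apply: cvgM; [exact: cvg_cst|exact: cvg_inv_scale].
rewrite mulr0 addr0 => /cvgr_lt/(_ _ hb) near_b.
have near_s1 : \forall n \near \oo, scale n < 1.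
  by move/cvgr_lt: cvg_scale; apply.
near=> n; apply: (@le_lt_trans _ _ (expR (- x n) + del n)); last by near: n; exact: near_b.
have n0 : (2 * d < n)%N by near: n; exact: nbhs_infty_gt.
have s0 : 0 < scale n by apply: scale_gt0; lia.
have s1 : scale n < 1 by near: n; exact: near_s1.
have nr0 : 0 < n%:R :> R by rewrite ltr0n; lia.
have p01 : 0 <= p n <= 1.
  apply/andP; split; first by rewrite mulr_ge0 ?ltW // subr_gt0.
  by apply: mulr_ile1; lra.
have npy : n%:R * p n < n%:R * scale n.
  by rewrite ltr_pM2l // /p gtr_pMl // ltrBlDr ltrDl.
have ch := large_prob_chebyshev p01 npy.
have up := le_trans (tail_prob_upper n d p01 _) (pattern_free_exp_le n d0 L p01).
have {up} := up (n%:R * scale n).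
have ee : (n %/ M)%:R * (L%:R * p n ^+ (2 * d) * (1 - L.+1%:R * p n)) = x n.
  by rewrite /x; field; rewrite gt_eqF.
rewrite -/M ee => up.
have de : n%:R * p n / (n%:R * scale n - n%:R * p n) ^+ 2 = del n.
  rewrite /del /p; field.
  by rewrite !gt_eqF //= subr_gt0.
rewrite de in ch.
have T0 := tail_prob_ge0 n d (n%:R * scale n).
have T1 := tail_prob_le1 n d (n%:R * scale n).
rewrite -/(T n) in T0 T1 up *.
have : T n * (1 - small_prob (p n) n (n%:R * scale n)) <= 1 - small_prob (p n) n (n%:R * scale n).
  apply: ler_piMl => //; rewrite large_prob; apply: bern_ge0 => // s _; exact: ler0n.
rewrite mulrBr mulr1; lra.
Unshelve. all: by end_near. Qed.

(** The same with [p = (1 + e) rho], where [(1 - p^(2d))^n] is close to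
    [exp(-(n p^(2d)))]. *)
Lemma tail_near_ge (e : R) (b : R) : 0 < e ->
  b < expR (- ((1 + e) ^+ (2 * d) * t)) ->
  \forall n \near \oo, b < T n.
Proof.
move=> e0 hb.
pose p n := (1 + e) * scale n.
pose x n : R := n%:R * p n ^+ (2 * d) / (1 - p n ^+ (2 * d)).
pose del n := (1 + e) / e ^+ 2 * (n%:R * scale n)^-1.
have cp : p @ \oo --> (0 : R).
  rewrite -[X in _ --> X](mulr0 (1 + e)); apply: cvgM; [exact: cvg_cst|exact: cvg_scale].
have cpX : p n ^+ (2 * d) @[n --> \oo] --> (0 : R).
  have -> : (0 : R) = 0 ^+ (2 * d) by rewrite expr0n muln_eq0 (gtn_eqF d0).
  exact: cvg_exprn.
have xl : x @ \oo --> (1 + e) ^+ (2 * d) * t.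
  have -> : (1 + e) ^+ (2 * d) * t = (1 + e) ^+ (2 * d) * t * (1 - 0)^-1.
    by rewrite subr0 invr1 mulr1.
  apply: cvgM; first exact: cvg_pow_scale.
  apply: cvgV; first by rewrite subr0 oner_eq0.
  by apply: cvgB => //; exact: cvg_cst.
have : (expR (- x n) - del n) @[n --> \oo] -->
    expR (- ((1 + e) ^+ (2 * d) * t)) - (1 + e) / e ^+ 2 * 0.
  apply: cvgB.
    exact: cvg_expRN.
  by apply: cvgM; [exact: cvg_cst|exact: cvg_inv_scale].
rewrite mulr0 subr0 => /cvgr_gt/(_ _ hb) near_b.
have near_p1 : \forall n \near \oo, p n < 1 by move/cvgr_lt: cp; apply.
near=> n; apply: (@lt_le_trans _ _ (expR (- x n) - del n)); first by near: n; exact: near_b.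
have n0 : (2 * d < n)%N by near: n; exact: nbhs_infty_gt.
have s0 : 0 < scale n by apply: scale_gt0; lia.
have nr0 : 0 < n%:R :> R by rewrite ltr0n; lia.
have p1 : p n < 1 by near: n; exact: near_p1.
have p01 : 0 <= p n <= 1 by rewrite (ltW p1) andbT mulr_ge0 ?ltW //; lra.
have npy : n%:R * scale n < n%:R * p n.
  by rewrite ltr_pM2l // /p ltr_pMl // ltrDl.
have ch := small_prob_chebyshev p01 npy.
have lo := tail_prob_lower p01 n0 (n%:R * scale n).
have px : 0 <= p n ^+ (2 * d) < 1.
  case/andP: p01 => p0 _; rewrite exprn_ge0 //= exprn_ilt1 //.
  by rewrite muln_eq0 (gtn_eqF d0).
have := exp_le_one_sub_pow n px; rewrite mulrA -/(x n).
have de : n%:R * p n / (n%:R * p n - n%:R * scale n) ^+ 2 = del n.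
  rewrite /del /p; field.
  by rewrite !gt_eqF //= subr_gt0.
rewrite de in ch.
rewrite -/(T n) in lo *; lra.
Unshelve. all: by end_near. Qed.

(** Both estimates approach [exp(-t)] when [e] tends to [0] and [L] to infinity;
    [e = 1/(m+2)] and [L = m+1] do this along one parameter. *)
Lemma cvg_tail : T @ \oo --> expR (- t).
Proof.
have inv_m : ((m.+2)%:R^-1 : R) @[m --> \oo] --> (0 : R).
  by have := @cvg_harmonic R; rewrite -cvg_shiftS.
have e01 m : 0 < (m.+2%:R^-1 : R) < 1.
  by rewrite invr_gt0 ltr0n /= invf_lt1 ?ltr0n // ltr1n.
have powl (f : nat -> R) : f @ \oo --> (1 : R) -> f m ^+ (2 * d) @[m --> \oo] --> (1 : R).
  move=> fl; rewrite -(expr1n _ (2 * d)); exact: cvg_exprn.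
have lowl : expR (- ((1 + (m.+2)%:R^-1) ^+ (2 * d) * t)) @[m --> \oo] --> expR (- t).
  apply: cvg_expRN; rewrite -[X in _ --> X]mul1r.
  apply: cvgM; last exact: cvg_cst.
  apply: powl; rewrite -[X in _ --> X]addr0; apply: cvgD => //; exact: cvg_cst.
have upl : expR (- (m.+1%:R / (m.+1 + 2 * d)%:R * (1 - (m.+2)%:R^-1) ^+ (2 * d) * t))
    @[m --> \oo] --> expR (- t).
  apply: cvg_expRN; rewrite -[X in _ --> X]mul1r.
  apply: cvgM; last exact: cvg_cst.
  rewrite -[X in _ --> X]mul1r; apply: cvgM; last first.
    apply: powl; rewrite -[X in _ --> X]subr0; apply: cvgB => //; exact: cvg_cst.
  have -> : (fun m => m.+1%:R / (m.+1 + 2 * d)%:R : R) =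
      (fun m => (1 + (2 * d)%:R * (m.+1)%:R^-1)^-1).
    apply/funext => m; rewrite natrD.
    move: (ltr0Sn R m) (ler0n R (2 * d)%N).
    move: (m.+1%:R : R) ((2 * d)%:R : R) => u v u0 v0; field.
    by rewrite !gt_eqF ?ltr_wpDr.
  rewrite -[X in _ --> X]invr1; apply: cvgV; first exact: oner_neq0.
  rewrite -[X in _ --> X]addr0 -[X in _ --> _ + X](mulr0 (2 * d)%:R).
  apply: cvgD; first exact: cvg_cst.
  by apply: cvgM; [exact: cvg_cst|exact: cvg_harmonic].
apply/cvgrPdist_lt => eps eps0.
have [m hm] : exists m, expR (- t) - eps < expR (- ((1 + (m.+2)%:R^-1) ^+ (2 * d) * t)).
  by apply: (@filter_ex _ \oo); move/cvgr_gt: lowl; apply; rewrite ltrBlDr ltrDl.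
have [k hk] : exists m,
    expR (- (m.+1%:R / (m.+1 + 2 * d)%:R * (1 - (m.+2)%:R^-1) ^+ (2 * d) * t)) < expR (- t) + eps.
  by apply: (@filter_ex _ \oo); move/cvgr_lt: upl; apply; rewrite ltrDl.
have m0 : 0 < (m.+2)%:R^-1 :> R by case/andP: (e01 m).
have n1 := tail_near_ge m0 hm.
have n2 := tail_near_le (e01 k) hk.
near=> n.
rewrite ltr_norml; apply/andP; split; rewrite ?ltrBlDr.
  have : T n < expR (- t) + eps by near: n; exact: n2.
  lra.
have : expR (- t) - eps < T n by near: n; exact: n1.
lra.
Unshelve. all: by end_near. Qed.

End Limit.

(** * Integrals *)

Section GammaIntegral.
Variable R : realType.
Notation mu := (@lebesgue_measure R).
Implicit Types (c s t w u : R).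

Let D : set R := `]0, +oo[%classic.
Let mD : measurable (D : set (measurableTypeR R)). Proof. exact: measurable_itv. Qed.

Lemma measurable_expMN c : measurable_fun setT (fun t : R => c * expR (- (c * t))).
Proof.
apply: measurable_funM => //; apply: measurableT_comp => //.
by apply: measurableT_comp => //; exact: measurable_funM.
Qed.

Lemma integral_oo_cst (a b k : R) : a <= b ->
  (\int[mu]_(t in `]a, b[) cst k%:E t = (k * (b - a))%:E)%E.
Proof.
move=> ab; rewrite integral_cst; last exact: measurable_itv.
have -> : (k * (b - a))%:E = (k%:E * (b - a)%:E)%E by [].
congr (_ * _)%E; apply: etrans (lebesgue_measure_itv _) _ => /=.
rewrite lte_fin; case: ltrP => // ba.
by have -> : b - a = 0 by lra.
Qed.

Lemma integral_exp_tail c u : 0 < c ->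
  (\int[mu]_(t in `]u, +oo[) (c * expR (- (c * t)))%:E = (expR (- (c * u)))%:E)%E.
Proof.
move=> c0.
have cE : continuous (fun t : R => expR (- (c * t))).
  move=> t; apply: (@continuous_comp _ _ _ (fun t => - (c * t)) expR).
    by apply: cvgN; apply: cvgM; [exact: cvg_cst|exact: cvg_id].
  exact: continuous_expR.
rewrite integral_itv_obnd_cbnd; last first.
  apply/measurable_EFinP; apply: measurable_funS (measurable_expMN c) => //.
have -> : (expR (- (c * u)))%:E = (0%:E - (- expR (- (c * u)))%:E)%E.
  by rewrite -EFinB sub0r opprK.
apply: (@ge0_continuous_FTC2y R _ (fun t => - expR (- (c * t)))).
- by move=> x _; rewrite mulr_ge0 ?expR_ge0 ?ltW.
- apply: continuous_subspaceT => t; apply: cvgM; [exact: cvg_cst|exact: cE].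
- rewrite -oppr0; apply: cvgN.
  apply: (@cvg_comp _ _ _ (fun t => c * t) (fun z => expR (- z)) _ (pinfty_nbhs R)).
    exact: gt0_cvgMry.
  exact: cvgr_expR.
- by move=> x _; exact: ex_derive.
- by apply: cvgN; apply: cvg_at_right_filter; exact: cE.
- move=> x _; rewrite derive1E.
  by rewrite derive_val /GRing.scale /= ; ring.
Qed.

Lemma ltr_powR_inv s w t : 0 < s -> 0 < w -> 0 <= t ->
  (w `^ s^-1 < t) = (w < t `^ s).
Proof.
move=> s0 w0 t0.
have e : (w `^ s^-1) `^ s = w by rewrite -powRrM mulVf ?gt_eqF // powRr1 // ltW.
apply/idP/idP => h.
  by rewrite -e gt0_ltr_powR ?nnegrE ?powR_ge0.
rewrite ltNge; apply/negP => h2.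
have := ge0_ler_powR (ltW s0) t0 (powR_ge0 _ _) h2.
by rewrite e leNgt h.
Qed.

(** Tonelli for [c exp(-ct)] on the region [0 < w < t^s]: integrating in [w]
    first produces [t^s], integrating in [t] first produces the exponential tail
    beyond [w^(1/s)]. Unlike an integration by parts, this does not involve the
    derivative of [t^s], which is singular at [0] when [s < 1]. *)
Lemma gamma_layer s c : 0 < s -> 0 < c ->
  (\int[mu]_(t in D) (t `^ s * (c * expR (- (c * t))))%:E =
   \int[mu]_(w in D) (expR (- (c * w `^ s^-1)))%:E)%E.
Proof.
move=> s0 c0.
pose f (z : R * R) : \bar R :=
  (if (0 < z.1) && (0 < z.2) && (z.2 < z.1 `^ s) then c * expR (- (c * z.1)) else 0)%:E.
have mf : measurable_fun setT f.
  apply/measurable_EFinP; apply: measurable_fun_ifT => //.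
    apply: measurable_and; first apply: measurable_and.
    - exact: measurable_fun_ltr.
    - exact: measurable_fun_ltr.
    - apply: measurable_fun_ltr => //.
      by apply: (measurableT_comp (measurable_powR s)).
  exact: (measurableT_comp (measurable_expMN c)).
have f0 z : (0 <= f z)%E.
  by rewrite lee_fin; case: ifP => // _; rewrite mulr_ge0 ?expR_ge0 ?ltW.
have := fubini_tonelli (m1 := mu) (m2 := mu) f mf f0.
have -> : (fun t => \int[mu]_w f (t, w))%E =
    (fun t => (t `^ s * (c * expR (- (c * t))))%:E) \_ D.
  apply/funext => t; rewrite patchE; case: ifPn => [|nD].
    rewrite inE /D /= in_itv /= ?andbT => t0.
    have -> : (fun w => f (t, w)) = (cst (c * expR (- (c * t)))%:E) \_ `]0, t `^ s[.
      apply/funext => w; rewrite patchE mem_setE in_itv /f /= t0 /=.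
      by case: ifP.
    by rewrite -integral_mkcond integral_oo_cst ?powR_ge0 // subr0 mulrC.
  apply: integral0_eq => w _; rewrite /f /=.
  have -> // : (0 < t) = false.
  by apply/negbTE; apply: contra nD => t0; rewrite inE /D /= in_itv /= t0.
have -> : (fun w => \int[mu]_t f (t, w))%E =
    (fun w => (expR (- (c * w `^ s^-1)))%:E) \_ D.
  apply/funext => w; rewrite patchE; case: ifPn => [|nD].
    rewrite inE /D /= in_itv /= ?andbT => w0.
    have -> : (fun t => f (t, w)) =
        (fun t => (c * expR (- (c * t)))%:E) \_ `]w `^ s^-1, +oo[.
      apply/funext => t; rewrite patchE mem_setE in_itv /f /= w0 !andbT.
      have [t0|t0] := ltrP 0 t; first by rewrite (ltr_powR_inv s0 w0 (ltW t0)) /=; case: (w < _).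
      by rewrite ifF //; apply/negbTE; rewrite -leNgt (le_trans t0) // powR_ge0.
    by rewrite -integral_mkcond integral_exp_tail.
  apply: integral0_eq => t _; rewrite /f /=.
  have -> : (0 < w) = false; last by rewrite andbF.
  by apply/negbTE; apply: contra nD => w0; rewrite inE /D /= in_itv /= w0.
by rewrite -!integral_mkcond.
Qed.

(** This is [ln x <= x - 1], weakened to [ln x <= x], at [x = c t / s]. *)
Lemma powR_le_exp s c t : 0 < s -> 0 < c -> 0 < t ->
  t `^ s <= (s / c) `^ s * expR (c * t).
Proof.
move=> s0 c0 t0; set x := t / (s / c).
have sc : 0 < s / c by exact: divr_gt0.
have -> : t = (s / c) * x by rewrite /x mulrC divfK // gt_eqF.
have x0 : 0 < x by exact: divr_gt0.
rewrite (powRM _ (ltW sc) (ltW x0)) ler_pM2l ?powR_gt0 //.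
have -> : c * (s / c * x) = s * x by field; rewrite gt_eqF.
rewrite /powR gt_eqF // ler_expR ler_pM2l //.
have := expR_ge1Dx (ln x); rewrite lnK ?posrE //.
by apply: le_trans; rewrite lerDr.
Qed.

Lemma measurable_gamma s c : measurable_fun setT (fun t : R => t `^ s * (c * expR (- (c * t)))).
Proof.
apply: measurable_funM; [exact: measurable_powR|exact: measurable_expMN].
Qed.

(** Half of the exponential absorbs the power. *)
Lemma gamma_integrable s c : 0 < s -> 0 < c ->
  mu.-integrable D (fun t => (t `^ s * (c * expR (- (c * t))))%:E).
Proof.
move=> s0 c0.
have c2 : 0 < c / 2 by rewrite divr_gt0.
pose C := 2 * (s / (c / 2)) `^ s.
have ig : mu.-integrable D (fun t => (C * (c / 2 * expR (- (c / 2 * t))))%:E).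
  have ie : mu.-integrable D (fun t => (c / 2 * expR (- (c / 2 * t)))%:E).
    apply/integrableP; split.
      by apply/measurable_EFinP; apply: measurable_funS (measurable_expMN _).
    under eq_integral => t _.
      rewrite gee0_abs; last by rewrite lee_fin mulr_ge0 ?expR_ge0 ?ltW.
      over.
    by rewrite integral_exp_tail // ltry.
  have := integrableZl mD C ie.
  by congr (_.-integrable _ _); apply/funext => t /=; rewrite EFinM.
apply: (le_integrable mD _ _ ig).
- apply/measurable_EFinP; apply: measurable_funS (measurable_gamma s c) => //.
- move=> t; rewrite /D /= in_itv /= ?andbT => t0.
  rewrite lee_fin !ger0_norm; last 2 first.
  + by rewrite !mulr_ge0 ?powR_ge0 ?expR_ge0 ?ltW.
  + by rewrite !mulr_ge0 ?powR_ge0 ?expR_ge0 ?ltW.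
  apply: (@le_trans _ _ ((s / (c / 2)) `^ s * expR (c / 2 * t) * (c * expR (- (c * t))))).
    by rewrite ler_wpM2r ?powR_le_exp // mulr_ge0 ?expR_ge0 ?ltW.
  have -> : expR (- (c * t)) = expR (- (c / 2 * t)) * expR (- (c / 2 * t)).
    by rewrite -expRD; congr expR; field.
  rewrite /C le_eqVlt; apply/orP; left; apply/eqP.
  have e : expR (c / 2 * t) * expR (- (c / 2 * t)) = 1.
    by rewrite -expRD subrr expR0.
  rewrite [LHS](_ : _ = (s / (c / 2)) `^ s * c * expR (- (c / 2 * t)) *
    (expR (c / 2 * t) * expR (- (c / 2 * t)))); last by ring.
  by rewrite e; field.
Qed.

Lemma measurable_exp_powR s c : measurable_fun setT (fun w : R => expR (- (c * w `^ s))).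
Proof.
apply: measurableT_comp => //; apply: measurableT_comp => //.
by apply: measurable_funM => //; exact: measurable_powR.
Qed.

Lemma exp_powR_integrable s c : 0 < s -> 0 < c ->
  mu.-integrable D (fun w => (expR (- (c * w `^ s^-1)))%:E).
Proof.
move=> s0 c0; apply/integrableP; split.
  by apply/measurable_EFinP; apply: measurable_funS (measurable_exp_powR _ _).
under eq_integral => t _.
  rewrite gee0_abs; last by rewrite lee_fin expR_ge0.
  over.
rewrite -gamma_layer //.
have /integrableP[_] := gamma_integrable s0 c0.
congr (_ < _)%E; apply: eq_integral => t; rewrite inE /D /= in_itv /= ?andbT => t0.
by rewrite ger0_norm // !mulr_ge0 ?powR_ge0 ?expR_ge0 ?ltW.
Qed.

Lemma GammaE s : Gamma (1 + s) = Rintegral mu D (fun t => t `^ s * (1 * expR (- (1 * t)))).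
Proof.
rewrite /Gamma; apply: eq_Rintegral => t _.
by rewrite addrAC subrr add0r !mul1r.
Qed.

Lemma Gamma_EFin s : 0 < s ->
  (Gamma (1 + s))%:E = (\int[mu]_(w in D) (expR (- w `^ s^-1))%:E)%E.
Proof.
move=> s0; rewrite GammaE /Rintegral fineK; last first.
  by apply: integrable_fin_num => //; exact: gamma_integrable.
by rewrite gamma_layer //; apply: eq_integral => w _; rewrite mul1r.
Qed.

Lemma integral_ge_const (f : R -> R) (T delta : R) : 0 <= T -> 0 <= delta ->
  measurable_fun D f ->
  (forall t, 0 < t -> 0 <= f t) -> (forall t, T < t < T + 1 -> delta <= f t) ->
  (delta%:E <= \int[mu]_(t in D) (f t)%:E)%E.
Proof.
move=> T0 de0 mf f0 fd.
have sub : `]T, T + 1[ `<=` D.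
  move=> t; rewrite /D /= !in_itv /= ?andbT => /andP[Tt _]; exact: le_lt_trans Tt.
have mfT : measurable_fun `]T, T + 1[ (EFin \o f).
  by apply/measurable_EFinP; exact: measurable_funS mf.
have -> : delta%:E = (\int[mu]_(t in `]T, (T + 1)%R[) (cst delta%:E) t)%E.
  by rewrite integral_oo_cst ?lerDl // addrAC subrr add0r mulr1.
apply: (@le_trans _ _ (\int[mu]_(t in `]T, (T + 1)%R[) (f t)%:E)%E).
  apply: ge0_le_integral.
  - exact: measurable_itv.
  - by move=> t _; rewrite lee_fin.
  - exact: measurable_cst.
  - exact: mfT.
  - by move=> t /=; rewrite in_itv /= => h; rewrite lee_fin fd.
apply: ge0_subset_integral => //.
- exact/measurable_EFinP.
by move=> t; rewrite /D /= in_itv /= ?andbT => t0; rewrite lee_fin f0.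
Qed.

Lemma Gamma_gt0 s : 0 < s -> 0 < Gamma (1 + s).
Proof.
move=> s0; rewrite -lte_fin GammaE /Rintegral fineK; last first.
  by apply: integrable_fin_num => //; exact: gamma_integrable.
apply: (@lt_le_trans _ _ (expR (- (1 * 2)))%:E); first by rewrite lte_fin expR_gt0.
apply: (@integral_ge_const _ 1) => //.
- exact: measurable_funS (measurable_gamma _ _).
- by move=> t t0; rewrite !mulr_ge0 ?powR_ge0 ?expR_ge0.
- move=> t /andP[t1 t2]; rewrite !mul1r -[leLHS]mul1r.
  apply: ler_pM; rewrite ?expR_ge0 // ?ler_expR; last lra.
  have := @ge0_ler_powR R s (ltW s0) 1 t; rewrite powR1 !nnegrE; apply; lra.
Qed.

(** The difference is the integral of [(t^s - m)^2 exp(-t)] with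
    [m = Gamma(1+s)], and [(t^s - m)^2 >= 1] as soon as [t^s >= m + 1]. *)
Lemma Gamma_var_gt0 s : 0 < s -> 0 < Gamma (1 + 2 * s) - Gamma (1 + s) ^+ 2.
Proof.
move=> s0; set m := Gamma (1 + s).
have s20 : 0 < 2 * s by rewrite mulr_gt0.
pose g a t : R := t `^ a * (1 * expR (- (1 * t))).
pose e (t : R) : R := 1 * expR (- (1 * t)).
have ig a : 0 < a -> mu.-integrable D (EFin \o g a).
  by move=> a0; exact: gamma_integrable.
have ie : mu.-integrable D (EFin \o e).
  apply/integrableP; split.
    by apply/measurable_EFinP; apply: measurable_funS (measurable_expMN _).
  under eq_integral => t _.
    rewrite gee0_abs; last by rewrite lee_fin mulr_ge0 ?expR_ge0.
    over.
  by rewrite integral_exp_tail // ltry.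
have Ie : Rintegral mu D e = 1.
  by rewrite /Rintegral integral_exp_tail //= mulr0 oppr0 expR0.
have Z a h : mu.-integrable D (EFin \o h) -> mu.-integrable D (EFin \o (fun t => a * h t)).
  move=> ih; have := integrableZl mD a ih.
  by congr (_.-integrable _ _); apply/funext => t /=; rewrite EFinM.
have iB : mu.-integrable D (EFin \o (fun t => g (2 * s) t - (2 * m) * g s t)).
  by have := integrableB mD (ig _ s20) (Z (2 * m) _ (ig _ s0)).
have -> : Gamma (1 + 2 * s) - m ^+ 2 =
    Rintegral mu D (fun t => g (2 * s) t - (2 * m) * g s t + m ^+ 2 * e t).
  rewrite RintegralD //; last exact: Z.
  rewrite RintegralB //; [|exact: ig|by apply: Z; exact: ig].
  rewrite (RintegralZl (2 * m) mD (ig _ s0)) (RintegralZl (m ^+ 2) mD ie).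
  by rewrite -!GammaE Ie -/m; ring.
have iS : mu.-integrable D (EFin \o (fun t => g (2 * s) t - (2 * m) * g s t + m ^+ 2 * e t)).
  by have := integrableD mD iB (Z (m ^+ 2) _ ie).
rewrite -lte_fin /Rintegral fineK; last exact: integrable_fin_num.
pose T := (m + 1) `^ s^-1.
have m0 : 0 < m by exact: Gamma_gt0.
have m10 : 0 <= m + 1 by lra.
apply: (@lt_le_trans _ _ (expR (- (T + 1)))%:E); first by rewrite lte_fin expR_gt0.
have E t : g (2 * s) t - (2 * m) * g s t + m ^+ 2 * e t = (t `^ s - m) ^+ 2 * expR (- t).
  by rewrite /g /e [2 * s]mulrC powRrM powR_mulrn ?powR_ge0 // !mul1r; ring.
apply: (@integral_ge_const _ T) => //.
- exact: powR_ge0.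
- by have /integrableP[/measurable_EFinP] := iS.
- by move=> t t0; rewrite E mulr_ge0 ?sqr_ge0 ?expR_ge0.
- move=> t /andP[t1 t2]; rewrite E -[leLHS]mul1r.
  apply: ler_pM; rewrite ?expR_ge0 // ?ler_expR; last lra.
  have t0 : 0 <= t by apply: ltW; apply: le_lt_trans t1; exact: powR_ge0.
  have h : m + 1 < t `^ s by rewrite -ltr_powR_inv //; lra.
  by rewrite -(expr1n _ 2) ler_pXn2r ?nnegrE //; lra.
Qed.

Lemma layer_cake (x : R) : 0 <= x ->
  (\int[mu]_(w in D) ((w < x)%R%:R : R)%:E = x%:E)%E.
Proof.
move=> x0.
rewrite -[in RHS](mul1r x) -[in RHS](subr0 x) -integral_oo_cst // integral_mkcond [RHS]integral_mkcond.
congr integral; apply/funext => w; rewrite !patchE !mem_setE !in_itv /= ?andbT.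
by case: (0 < w) => //=; case: (w < x).
Qed.

Lemma measurable_ltr_cst (x : R) : measurable_fun setT (fun w : R => (w < x)%R%:R : R).
Proof.
rewrite (_ : (fun w => _) = (fun w => if w < x then 1 else 0)).
  by apply: measurable_fun_ifT => //; exact: measurable_fun_ltr.
by apply/funext => w; case: ifP.
Qed.

Lemma measurable_unif_tail (T : finType) (W : T -> R) :
  measurable_fun setT (fun w : R => unif_expectation (fun v : T => (w < W v)%R%:R : R)).
Proof.
rewrite /unif_expectation; apply: measurable_funM => //.
by apply: measurable_sum => v; exact: measurable_ltr_cst.
Qed.

Lemma unif_layer_cake (T : finType) (W : T -> R) : (forall v, 0 <= W v) ->
  (\int[mu]_(w in D) (unif_expectation (fun v : T => (w < W v)%R%:R : R))%:E =
   (unif_expectation W)%:E)%E.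
Proof.
move=> W0; rewrite /unif_expectation.
under eq_integral do rewrite mulrC EFinM.
rewrite ge0_integralZl //; last 2 first.
- apply/measurable_EFinP; apply: (@measurable_funS _ _ _ _ setT) => //.
  by apply: measurable_sum => v; exact: measurable_ltr_cst.
- by move=> w _; rewrite lee_fin sumr_ge0.
under eq_integral do rewrite -sumEFin.
rewrite ge0_integral_sum //; last first.
  by move=> v; apply/measurable_EFinP; exact: measurable_funS (measurable_ltr_cst _).
under eq_bigr do rewrite layer_cake //.
by rewrite sumEFin -EFinM mulrC.
Qed.

End GammaIntegral.

(** * Moments *)

Section Moments.
Variables (R : realType) (d : nat).
Hypothesis d0 : (0 < d)%N.
Notation mu := (@lebesgue_measure R).

Definition norm_const (n : nat) : R := n%:R `^ (1 - 1 / (2 * d%:R)).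

Definition scaled_power (r : R) n (s : 'S_n) : R := ((remaining d s)%:R / norm_const n) `^ r.

Lemma norm_const_gt0 n : (0 < n)%N -> 0 < norm_const n.
Proof. by move=> n0; rewrite powR_gt0 // ltr0n. Qed.

Lemma d2_gt0 : 0 < 2 * d%:R :> R.
Proof. by rewrite mulr_gt0 // ltr0n. Qed.

(** The rescaling that turns [(K/a)^r > w] into [K > n rho], with
    [t = w^(2d/r)]. *)
Lemma scale_norm r w n : 0 < r -> 0 < w -> (0 < n)%N ->
  n%:R * scale d (w `^ (r / (2 * d%:R))^-1) n = w `^ r^-1 * norm_const n.
Proof.
move=> r0 w0 n0; have nr0 : 0 < n%:R :> R by rewrite ltr0n.
have dd := d2_gt0; rewrite /scale natrM.
set q := (2 * d%:R)^-1; set t := w `^ _; set sc := (t / n%:R) `^ q.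
have e1 : sc * n%:R `^ q = w `^ r^-1.
  rewrite /sc -powRM ?divr_ge0 ?powR_ge0 ?ltW // divfK ?gt_eqF // /t -powRrM.
  by congr (_ `^ _); rewrite /q; field; rewrite !gt_eqF // ltr0n.
have e2 : norm_const n * n%:R `^ q = n%:R.
  rewrite /norm_const -powRD; last by rewrite (gt_eqF nr0) implybT.
  by rewrite div1r subrK powRr1 // ltW.
by rewrite -{1}e2 -e1; ring.
Qed.

Lemma moment_tail r w n : 0 < r -> 0 < w -> (0 < n)%N ->
  unif_expectation (fun s : 'S_n => (w < scaled_power r s)%R%:R) =
  tail_prob n d (n%:R * scale d (w `^ (r / (2 * d%:R))^-1) n).
Proof.
move=> r0 w0 n0; apply: eq_unif => s; congr ((nat_of_bool _)%:R).
have a0 := norm_const_gt0 n0.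
rewrite scale_norm // -ltr_pdivlMr // ltr_powR_inv //.
by rewrite divr_ge0 ?ler0n // ltW.
Qed.

(** Layer-cake formula and dominated convergence. The sequence starts at
    [n = 2d + 1], from where the exponential bound on the tail holds. *)
Lemma moment_cvg (r : R) : 0 < r ->
  unif_expectation (@scaled_power r n) @[n --> \oo] --> Gamma (1 + r / (2 * d%:R)).
Proof.
move=> r0; set s := r / (2 * d%:R).
have s0 : 0 < s by rewrite divr_gt0 // d2_gt0.
pose N := (2 * d).+1.
rewrite -(cvg_shiftn N).
set D : set R := `]0, +oo[%classic.
have mD : measurable (D : set (measurableTypeR R)) by exact: measurable_itv.
pose f_ n (w : R) : \bar R :=
  (unif_expectation (fun v : 'S_(n + N) => (w < scaled_power r v)%R%:R))%:E.
pose f (w : R) : \bar R := (expR (- w `^ s^-1))%:E.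
pose g (w : R) : \bar R := (2%:E * (expR (- (rate R d * w `^ s^-1)))%:E)%E.
have ig : mu.-integrable D g.
  by apply: integrableZl => //; apply: exp_powR_integrable => //; exact: rate_gt0.
have Dpos w : D w -> 0 < w by rewrite /D /= in_itv /= andbT.
have key : (\int[mu]_(w in D) f_ n w)%E @[n --> \oo] --> (\int[mu]_(w in D) f w)%E.
  apply: (dominated_cvg mD _ _ _ ig).
  - move=> n; apply/measurable_EFinP; apply: (@measurable_funS _ _ _ _ setT) => //.
    exact: measurable_unif_tail.
  - move=> w /Dpos w0; apply: cvg_EFin; first exact: nearW.
    have t0 : 0 < w `^ s^-1 by exact: powR_gt0.
    have := cvg_tail d0 t0; rewrite -(cvg_shiftn N); apply: cvg_trans.
    apply: near_eq_cvg; apply: nearW => n /=.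
    by rewrite /f_ /= moment_tail // addnS.
  - by move=> w _; rewrite /g -EFinM.
  - move=> n w /Dpos w0; rewrite /f_ /g -EFinM lee_fin moment_tail ?addnS //.
    have nN : (2 * d < (n + 2 * d).+1)%N by lia.
    rewrite ger0_norm ?tail_prob_ge0 //.
    have t0 : 0 < w `^ s^-1 by exact: powR_gt0.
    have sc0 : 0 < scale d (w `^ s^-1) (n + 2 * d).+1 by exact: scale_gt0.
    apply: le_trans (tail_prob_exp d0 nN sc0) _.
    by rewrite scaleX_n.
have {key} : (unif_expectation (@scaled_power r (n + N)))%:E @[n --> \oo] --> (Gamma (1 + s))%:E.
  rewrite (Gamma_EFin s0) -/D -/f; apply: cvg_trans key.
  apply: near_eq_cvg; apply: nearW => n /=.
  by rewrite unif_layer_cake // => v; exact: powR_ge0.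
by move/fine_cvgP => [_].
Qed.

End Moments.

Theorem theorem6p6 (R : realType) (d : nat) (hd : (1 <= d)%N) :
  [/\ forall r : R, 0 < r ->
        (fun n : nat => unif_expectation (fun s : 'S_n =>
           ((remaining d s)%:R / n%:R `^ (1 - 1 / (2 * d%:R))) `^ r))
          @ \oo --> Gamma (1 + r / (2 * d%:R)),
      asymp_equiv
        (fun n : nat => unif_expectation (fun s : 'S_n =>
           (remaining d s)%:R : R))
        (fun n : nat => Gamma (1 + 1 / (2 * d%:R))
           * n%:R `^ (1 - 1 / (2 * d%:R)))
    & asymp_equiv
        (fun n : nat => unif_variance (fun s : 'S_n =>
           (remaining d s)%:R : R))
        (fun n : nat =>
           (Gamma (1 + 1 / d%:R) - Gamma (1 + 1 / (2 * d%:R)) ^+ 2)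
           * n%:R `^ (2 - 1 / d%:R)) ].
Proof.
have moments (r : R) : 0 < r ->
    unif_expectation (@scaled_power R d r n) @[n --> \oo] --> Gamma (1 + r / (2 * d%:R)).
  exact: moment_cvg.
have dd := d2_gt0 R hd.
have s0 : 0 < 1 / (2 * d%:R) :> R by rewrite divr_gt0.
pose X n (v : 'S_n) : R := (remaining d v)%:R.
pose a n : R := norm_const R d n.
have mean_cvg : (unif_expectation (@X n) / a n) @[n --> \oo] --> Gamma (1 + 1 / (2 * d%:R) : R).
  have := moments 1 ltr01; apply: cvg_trans; apply: near_eq_cvg; apply: nearW => n.
  rewrite mulrC -unifZ; apply: eq_unif => v.
  by rewrite /scaled_power powRr1 ?divr_ge0 ?ler0n ?powR_ge0 // mulrC.
have square_cvg : (unif_expectation (fun v => @X n v ^+ 2) / a n ^+ 2) @[n --> \oo]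
    --> Gamma (1 + 1 / d%:R : R).
  have -> : 1 / d%:R = 2 / (2 * d%:R) :> R by field; rewrite pnatr_eq0 -lt0n.
  have := moments 2 (ltr0Sn _ _); apply: cvg_trans; apply: near_eq_cvg; apply: nearW => n.
  rewrite mulrC -unifZ; apply: eq_unif => v.
  by rewrite /scaled_power powR_mulrn ?divr_ge0 ?ler0n ?powR_ge0 // exprMn exprVn mulrC.
split; first exact: moments.
- have G0 := Gamma_gt0 s0; rewrite /asymp_equiv.
  have : (unif_expectation (@X n) / a n / Gamma (1 + 1 / (2 * d%:R))) @[n --> \oo]
      --> Gamma (1 + 1 / (2 * d%:R)) / Gamma (1 + 1 / (2 * d%:R) : R).
    by apply: cvgM mean_cvg _; exact: cvg_cst.
  rewrite (mulfV (lt0r_neq0 G0)).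
  by apply: cvg_trans; apply: near_eq_cvg; apply: nearW => n /=; rewrite -mulrA -invfM [a n * _]mulrC.
- set V := Gamma _ - _.
  have V0 : 0 < V.
    have e : 2 * (1 / (2 * d%:R)) = 1 / d%:R :> R by field; rewrite pnatr_eq0 -lt0n.
    by have := Gamma_var_gt0 s0; rewrite e.
  rewrite /asymp_equiv.
  have : ((unif_expectation (fun v => @X n v ^+ 2) / a n ^+ 2
      - (unif_expectation (@X n) / a n) ^+ 2) / V) @[n --> \oo] --> V / V.
    by apply: cvgM; [apply: cvgB square_cvg _; exact: cvg_exprn|exact: cvg_cst].
  rewrite (mulfV (lt0r_neq0 V0)); apply: cvg_trans; apply: near_eq_cvg; near=> n.
  have n0 : (0 < n)%N by near: n; exact: nbhs_infty_gt.
  have a0 : 0 < a n by exact: norm_const_gt0.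
  have a2 : n%:R `^ (2 - 1 / d%:R) = a n ^+ 2.
    rewrite -powR_mulrn ?powR_ge0 // /a /norm_const -powRrM; congr (_ `^ _).
    by field; rewrite pnatr_eq0 -lt0n.
  have var : unif_variance (@X n) =
      unif_expectation (fun v => @X n v ^+ 2) - unif_expectation (@X n) ^+ 2.
    rewrite /unif_variance; set m := unif_expectation (@X n).
    rewrite (@eq_unif _ _ _ (fun v => X n v ^+ 2 + ((- (2 * m)) * X n v + m ^+ 2))); last first.
      by move=> v; ring.
    by rewrite !unifD unifZ unif_cst ?perm_card_gt0 // -/m; ring.
  rewrite a2 var /=.
  by field; rewrite !gt_eqF.
Unshelve. all: by end_near. Qed.
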